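(* Let $M$ be an even $\Delta$-matroid on $[n]$ with $\mathcal{B}(M)\subset E(n)$, let $w\in\mathrm{Trop}(\mathbb{S}_M)$, let $x$ be a $\mathbf{k}$-point of $\mathrm{in}_w\mathbb{S}_M$, and let $q$ be a $\mathbb{K}$-point of $\mathbb{S}_M$ whose exploded tropicalization is $x$ (so that $w$ is the vector of valuations of $q$ and $x$ is its vector of leading coefficients). Let $F_q\subset\mathbb{K}^{2n}$ be the totally isotropic subspace with Wick vector $q$ and $F_q^\circ=F_q\cap(\mathbb{K}^* )^{2n}$. Suppose $u\in\mathbb{R}^n$ satisfies $(-u,u)\in\mathrm{Trop}(F_q^\circ)$. Then the closure of $\mathrm{in}_{(-u,u)}F_q^\circ$ in $\mathbf{k}^{2n}$ is totally isotropic, and realizes the $\Delta$-matroid $M_u^w$.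
   Context: $\mathbf{k}$ is an algebraically closed field of characteristic $0$, $\mathbb{K}=\mathbf{k}(\!(t^{\mathbb{R}})\!)$ with its $t$-adic valuation $\mathrm{val}$ and residue field $\mathbf{k}$. $[n]=\{0,\dots,n-1\}$, $[n]^*=\{0^*,\dots,(n-1)^*\}$, $J=[n]\sqcup[n]^*$; coordinates on a $2n$-dimensional space are $y_i,y_{i^*}$ ($i\in[n]$), ordered $y_0,\dots,y_{n-1},y_{0^*},\dots,y_{(n-1)^*}$. $E(n)$ is the set of $\lambda\subset[n]$ with $n-|\lambda|$ even, $e_\lambda=\sum_{i\in\lambda}e_i\in\mathbb{R}^n$. A subspace $F$ of a $2n$-dimensional space is totally isotropic here if $\dim F=n$ and $x^TQy=0$ for all $x,y\in F$, $Q=\begin{bmatrix}0&I\\ I&0\end{bmatrix}$. For $\lambda\subset[n]$ put $\overline\lambda=\lambda\cup\{i^*:i\notin\lambda\}$. The $\Delta$-matroid of $F$ has bases $\{\lambda\subset[n]:p_{\overline\lambda}(F)\ne0\}$, $p$ denoting Plücker coordinates; $F$ realizes $M$ if $M$ is its $\Delta$-matroid. $\mathbb{S}_n$ is the variety of totally isotropic $F$ with $p_{\overline\lambda}(F)=0$ whenever $n-|\lambda|$ is odd, embedded in $\mathbb{P}(\mathbf{k}^{E(n)})$ by the Wick embedding, given on $F=\mathrm{rowspan}[I|X]$ ($X$ skew-symmetric) by $q_\lambda(F)=\mathrm{Pf}(X[[n]\setminus\lambda])$, where $X[\mu]$ is the principal submatrix on $\mu$; $q(F)$ is the Wick vector of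 $F$. Let $I_n$ be the homogeneous ideal of $\mathbb{S}_n$. An even $\Delta$-matroid $M$ is a nonempty collection $\mathcal{B}(M)$ of subsets of $[n]$ (bases), all pairwise symmetric differences having even size, such that for $\mu,\nu\in\mathcal{B}(M)$, $i\in\mu\Delta\nu$ there is $j\in\mu\Delta\nu$ with $\mu\Delta\{i,j\}\in\mathcal{B}(M)$. Let $B_M=\mathbf{k}[q_\lambda:\lambda\in\mathcal{B}(M)]$, $I_M=(\langle q_\lambda:\lambda\in E(n)\setminus\mathcal{B}(M)\rangle+I_n)\cap B_M$, $\mathbb{S}_M=T_M\cap\mathrm{Proj}(B_M/I_M)$, with $T_M$ the dense torus of $\mathrm{Proj}(B_M)$. For $w\in\mathbb{R}^{\mathcal{B}(M)}/\mathbb{R}(1,\dots,1)$: $\mathrm{in}_wf$ is the sum of terms of $f$ of minimal $w$-weight, $\mathrm{in}_wI_M=\langle\mathrm{in}_wf:f\in I_M\rangle$, $\mathrm{Trop}(\mathbb{S}_M)$ is the set of $w$ for which $\mathrm{in}_wI_M$ is not the unit ideal in the Laurent polynomial ring, and $\mathrm{in}_w\mathbb{S}_M=T_M\cap\mathrm{Proj}(B_M/\mathrm{in}_wI_M)$. For $u\in\mathbb{R}^n$, $M_u^w$ is the even $\Delta$-matroid with bases those $\lambda\in\mathcal{B}(M)$ minimizing $w_\lambda+\langle u,e_\lambda\rangle$ over $\mathcal{B}(M)$. For $v\in\mathbb{R}^{2n}$ and $f=\sum c_ay^a\in\mathbb{K}[y_i,y_{i^*}]$, $\mathrm{in}_vf=\sum\overline{t^{-\mathrm{val}(c_a)}c_a}\,y^a\in\mathbf{k}[y_i,y_{i^*}]$,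 the sum over $a$ with $c_a\neq 0$ and $\mathrm{val}(c_a)+\langle v,a\rangle$ minimal. With $I_{F_q}$ the ideal of $F_q$, $\mathrm{Trop}(F_q^\circ)$ is the set of $v$ such that the ideal $\mathrm{in}_vI_{F_q}=\langle\mathrm{in}_vf:f\in I_{F_q}\rangle$ is not the unit ideal in $\mathbf{k}[y_i^{\pm},y_{i^*}^{\pm}]$, and $\mathrm{in}_vF_q^\circ$ is the subscheme of $\mathrm{Spec}\,\mathbf{k}[y_i^{\pm},y_{i^*}^{\pm}]$ it defines. In $(-u,u)$, $y_i$ has weight $-u_i$ and $y_{i^*}$ has weight $u_i$. *)

(* Defs.v *)
From HB Require Import structures.
From mathcomp Require Import all_boot all_order all_algebra.
From mathcomp Require Import fraction finmap.
From mathcomp Require Import boolp classical_sets cardinality fsbigop reals.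
From mathcomp Require Import mpoly.

Set Implicit Arguments.
Unset Strict Implicit.
Unset Printing Implicit Defensive.

Import Order.TTheory GRing.Theory Num.Theory.

Local Open Scope classical_set_scope.
Local Open Scope ring_scope.

Definition well_ordered (R : realType) (A : set R) : Prop :=
  forall B : set R, B `<=` A -> B !=set0 ->
    exists2 b, B b & forall c, B c -> b <= c.

(* The field k((t^R)): formal series with well-ordered support; [f a] is the
   coefficient of t^a. *)
Record hahn (R : realType) (k : fieldType) := Hahn {
  coef :> R -> k;
  wo_supp : well_ordered [set a | coef a != 0] }.
Arguments wo_supp {R k} h.

Section WellOrdered.
Variable R : realType.
Implicit Types (A B D : set R).

Lemma wo_sub A B (AB : A `<=` B) (wB : well_ordered B) : well_ordered A.
Proof. by move=> C CA; apply: wB => x /CA /AB. Qed.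

Lemma wo_ind A (P : R -> Prop) : well_ordered A ->
  (forall a, A a -> (forall b, A b -> b < a -> P b) -> P a) ->
  forall a, A a -> P a.
Proof.
move=> wA IH a Aa; apply: contrapT => nPa.
have [||b [Ab nPb] bmin] := wA [set x | A x /\ ~ P x]; first by move=> x [].
  by exists a.
apply: nPb; apply: IH => // c Ac cb; apply: contrapT => nPc.
by have := bmin c (conj Ac nPc); rewrite leNgt cb.
Qed.

Lemma woU A B : well_ordered A -> well_ordered B -> well_ordered (A `|` B).
Proof.
move=> wA wB C CAB [c Cc].
have [[a [Aa Ca]]|nA] := pselect (exists a, A a /\ C a); last first.
  apply: wB; last by exists c.
  by move=> x Cx; case: (CAB x Cx) => // Ax; case: nA; exists x.
have [||a0 [Ca0 Aa0] a0min] := wA (C `&` A); first by move=> x [].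
  by exists a.
have [[b [Bb Cb]]|nB] := pselect (exists a, B a /\ C a); last first.
  exists a0 => // x Cx; apply: a0min; split=> //.
  by case: (CAB x Cx) => // Bx; case: nB; exists x.
have [||b0 [Cb0 Bb0] b0min] := wB (C `&` B); first by move=> x [].
  by exists b.
case: (leP a0 b0) => ab; [exists a0|exists b0] => // x Cx.
  case: (CAB x Cx) => ?; first exact: a0min.
  by apply: (le_trans ab); apply: b0min.
case: (CAB x Cx) => ?; last exact: b0min.
by apply: (le_trans (ltW ab)); apply: a0min.
Qed.

Lemma wo1 (a : R) : well_ordered [set a].
Proof. by move=> C Ca [c Cc]; exists c => // d /Ca ->; rewrite (Ca c Cc). Qed.

Lemma wo_finite D : well_ordered D ->
  (forall C, C `<=` D -> C !=set0 -> exists2 b, C b & forall c, C c -> c <= b) ->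
  finite_set D.
Proof.
move=> wD mD.
have key : forall a, D a -> finite_set (D `&` [set x | x <= a]).
  apply: (@wo_ind D _ wD) => a Da IH.
  have [[b [Db ba]]|nb] := pselect (exists b, D b /\ b < a); last first.
    apply: (@sub_finite_set _ _ [set a]); last exact: finite_set1.
    move=> x [Dx xa] /=; apply/eqP; rewrite eq_le [x <= a]xa leNgt.
    by apply/negP => xa'; apply: nb; exists x.
  have [||m [Dm ma] mmax] := mD (D `&` [set x | x < a]); first by move=> x [].
    by exists b.
  have fm := IH m Dm ma.
  apply: (@sub_finite_set _ _ ((D `&` [set x | x <= m]) `|` [set a])).
    move=> x [Dx /=]; rewrite le_eqVlt => /orP[/eqP->|xa]; first by right.
    by left; split => //=; apply: mmax.
  by rewrite finite_setU; split => //; exact: finite_set1.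
have [->|/set0P D0] := eqVneq D set0; first exact: finite_set0.
have [m Dm mm] := mD D (@subset_refl _ D) D0.
by apply: sub_finite_set (key m Dm) => x Dx; split => //=; apply: mm.
Qed.

Lemma wo_pair_finite A B (c : R) : well_ordered A -> well_ordered B ->
  finite_set [set a | A a /\ B (c - a)].
Proof.
move=> wA wB; apply: wo_finite; first by apply: wo_sub wA => x [].
move=> C CD [x Cx].
have [||b [y Cy <-] bmin] := wB ((fun a => c - a) @` C).
- by move=> _ [y Cy <-]; case: (CD y Cy).
- by exists (c - x), x.
exists y => // z Cz; have := bmin (c - z) (ex_intro2 _ _ z Cz erefl).
by rewrite lerD2l lerN2.
Qed.

Lemma woD A B : well_ordered A -> well_ordered B ->
  well_ordered [set c | exists2 a, A a & B (c - a)].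
Proof.
move=> wA wB C CAB [c0 Cc0].
pose P a b := [/\ A a, B b & C (a + b)].
have PE c : C c -> exists2 a, P a (c - a) & True.
  move=> Cc; have [a Aa Bb] := CAB c Cc; exists a => //.
  by split=> //; rewrite addrC subrK.
pose m a b := P a b /\
  forall a' b', P a' b' -> a' <= a -> b' <= b -> a' = a /\ b' = b.
have dom a b : P a b -> exists a' b', [/\ m a' b', a' <= a & b' <= b].
  move=> Pab.
  have [||a1 [a1a [b' b'b Pa1]] a1min] :=
    wA [set a' | a' <= a /\ exists2 b', b' <= b & P a' b'].
  - by move=> x [_ [y _ []]].
  - by exists a; split=> //; exists b.
  have [||b1 [b1b Pab1] b1min] := wB [set b' | b' <= b /\ P a1 b'].
  - by move=> x [_ []].
  - by exists b'.
  exists a1, b1; split=> //; split=> // a2 b2 P2 a21 b21.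
  have e : a2 = a1.
    apply/eqP; rewrite eq_le a21 /=; apply: a1min; split.
      exact: le_trans a1a.
    by exists b2 => //; apply: le_trans b1b.
  split=> //; apply/eqP; rewrite eq_le b21 /=; apply: b1min; split.
    exact: le_trans b1b.
  by rewrite -e.
pose D := [set a | exists b, m a b].
have fD : finite_set D.
  apply: wo_finite.
    by apply: wo_sub wA => a [b [[]]].
  move=> E ED [e Ee].
  have [||b [a Ea mab] bmin] := wB [set b | exists2 a, E a & m a b].
  - by move=> b [a _ [[]]].
  - by have [b mb] := ED e Ee; exists b, e.
  exists a => // a' Ea'; rewrite leNgt; apply/negP => aa'.
  have [b' mb'] := ED a' Ea'.
  have bb' : b <= b' by apply: bmin; exists a'.
  have [Pab _] := mab.
  have [/eqP] := mb'.2 a b Pab (ltW aa') bb'.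
  by rewrite lt_eqF.
have [r rE] := (finite_fsetP.1 fD).
pose g a := xget 0 (fun b => m a b).
have gP a : D a -> m a (g a) by move=> [b mb]; exact: (xgetPex 0 (ex_intro _ b mb)).
have gu a b : m a b -> b = g a.
  move=> mab; have mg : m a (g a) by apply: gP; exists b.
  case: (leP b (g a)) => h.
    by have [] := mg.2 a b mab.1 (lexx _) h.
  by have [] := mab.2 a (g a) mg.1 (lexx _) (ltW h).
have [s sE] : exists s : seq R, forall x, (x \in s) <-> D x.
  by exists r => x; rewrite rE.
have [a0 Da0] : D !=set0.
  have [a Pa _] := PE c0 Cc0; have [a' [b' [mab _ _]]] := dom _ _ Pa.
  by exists a', b'.
have : a0 \in s by apply/sE.
have : forall s' : seq R, a0 \in s' ->
    exists2 x, x \in s' & forall y, y \in s' -> x + g x <= y + g y.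
  elim=> [//|x s' IH _].
  case: s' IH => [|y s'] IH.
    by exists x; rewrite ?inE // => z; rewrite inE => /eqP ->.
  suff [z zs zmin] : exists2 z, z \in y :: s' &
      forall t, t \in y :: s' -> z + g z <= t + g t.
    case: (leP (x + g x) (z + g z)) => h.
      exists x; first by rewrite inE eqxx.
      by move=> t; rewrite inE => /orP[/eqP -> //|/zmin]; apply: le_trans.
    exists z; first by rewrite inE zs orbT.
    by move=> t; rewrite inE => /orP[/eqP ->|/zmin //]; apply: ltW.
  elim: s' y {IH} => [|y' s' IH'] y.
    by exists y; rewrite ?inE // => z; rewrite inE => /eqP ->.
  have [z zs zmin] := IH' y'.
  case: (leP (y + g y) (z + g z)) => h.
    exists y; first by rewrite inE eqxx.
    by move=> t; rewrite inE => /orP[/eqP -> //|/zmin]; apply: le_trans.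
  exists z; first by rewrite inE zs orbT.
  by move=> t; rewrite inE => /orP[/eqP ->|/zmin //]; apply: ltW.
move=> /(_ s) H /H [x xs xmin].
have Dx : D x by apply/sE.
have [[_ _ Cx] _] := gP x Dx.
exists (x + g x) => // c Cc.
have [a Pa _] := PE c Cc; have [a' [b' [mab a'a b'b]]] := dom _ _ Pa.
have := xmin a'; rewrite -(gu _ _ mab) => /(_ _)/le_trans; apply.
  by apply/sE; exists b'.
by have := lerD a'a b'b; rewrite addrCA subrr addr0.
Qed.

End WellOrdered.

Section HahnRing.
Variables (R : realType) (k : fieldType).
Local Notation K := (hahn R k).
Implicit Types (f g h : K).

HB.instance Definition _ := gen_eqMixin K.
HB.instance Definition _ := gen_choiceMixin K.

Lemma hahnP f g : (forall a, f a = g a) -> f = g.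
Proof.
case: f g => f pf [g pg] /= /funext e; subst g.
by rewrite (Prop_irrelevance pf pg).
Qed.

Lemma hahn0_wo : well_ordered [set a : R | (0 : k) != 0].
Proof. by move=> B B0 [b /B0]; rewrite /= eqxx. Qed.
Definition hahn0 : K := Hahn hahn0_wo.

Lemma hahn_opp_wo f : well_ordered [set a | - f a != 0].
Proof.
by apply: (wo_sub _ (wo_supp f)) => a /=; rewrite oppr_eq0.
Qed.
Definition hahn_opp f : K := Hahn (@hahn_opp_wo f).

Lemma hahn_add_wo f g : well_ordered [set a | f a + g a != 0].
Proof.
apply: (wo_sub _ (woU (wo_supp f) (wo_supp g))) => a /= fg.
case: (eqVneq (f a) 0) fg => [->|]; last by left.
by rewrite add0r; right.
Qed.
Definition hahn_add f g : K := Hahn (@hahn_add_wo f g).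

Definition hahn_conv f g (c : R) : k := \sum_(a \in [set: R]) f a * g (c - a).

Lemma conv_finite f g c : finite_set [set a | f a != 0 /\ g (c - a) != 0].
Proof. exact: wo_pair_finite (wo_supp f) (wo_supp g). Qed.

Lemma convE f g c (s : seq R) : uniq s ->
  (forall a, f a != 0 -> g (c - a) != 0 -> a \in s) ->
  hahn_conv f g c = \sum_(a <- s) f a * g (c - a).
Proof.
move=> us hs; rewrite /hahn_conv (fsbigE s) //=; last first.
  move=> a _ nas; apply/eqP; rewrite mulf_eq0 -[X in X || _]negbK -[X in _ || X]negbK.
  by rewrite -negb_and; apply: contra nas => /andP[]; exact: hs.
by apply: eq_bigl => a; rewrite in_setT.
Qed.

Lemma conv_seq f g c : exists2 s : seq R, uniq s &
  forall a, f a != 0 -> g (c - a) != 0 -> a \in s.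
Proof.
exists (fset_set [set a | f a != 0 /\ g (c - a) != 0]); first exact: fset_uniq.
by move=> a fa ga; rewrite in_fset_set ?inE //; apply: conv_finite.
Qed.

Lemma conv_neq0 f g c : hahn_conv f g c != 0 ->
  exists2 a, f a != 0 & g (c - a) != 0.
Proof.
apply: contra_neqP => H; rewrite (@convE f g c [::]) ?big_nil //.
by move=> a fa ga; case: H; exists a.
Qed.

Lemma hahn_mul_wo f g : well_ordered [set c | hahn_conv f g c != 0].
Proof.
apply: (wo_sub _ (woD (wo_supp f) (wo_supp g))) => c /=.
exact: conv_neq0.
Qed.
Definition hahn_mul f g : K := Hahn (@hahn_mul_wo f g).

Lemma hahn_mono_wo (r : R) (x : k) :
  well_ordered [set a | (if a == r then x else 0) != 0].
Proof.
by apply: (wo_sub _ (@wo1 R r)) => a /=; case: (a =P r) => // _; rewrite eqxx.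
Qed.

(* x t^r *)
Definition hahn_mono (r : R) (x : k) : K := Hahn (@hahn_mono_wo r x).

Lemma hahn_addA : associative hahn_add.
Proof. by move=> f g h; apply: hahnP => a /=; rewrite addrA. Qed.
Lemma hahn_addC : commutative hahn_add.
Proof. by move=> f g; apply: hahnP => a /=; rewrite addrC. Qed.
Lemma hahn_add0 : left_id hahn0 hahn_add.
Proof. by move=> f; apply: hahnP => a /=; rewrite add0r. Qed.
Lemma hahn_addN : left_inverse hahn0 hahn_opp hahn_add.
Proof. by move=> f; apply: hahnP => a /=; rewrite addNr. Qed.

HB.instance Definition _ :=
  GRing.isZmodule.Build K hahn_addA hahn_addC hahn_add0 hahn_addN.

Lemma hahn_mulC : commutative hahn_mul.
Proof.
move=> f g; apply: hahnP => c /=; have [s us hs] := conv_seq g f c.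
rewrite (@convE g f c s) // (@convE f g c [seq c - a | a <- s]).
- rewrite big_map; apply: eq_bigr => a _; rewrite mulrC.
  by rewrite opprB addrCA subrr addr0.
- by rewrite map_inj_uniq // => x y /addrI /oppr_inj.
move=> a fa ga; apply/mapP; exists (c - a).
  by apply: hs => //; rewrite opprB addrCA subrr addr0.
by rewrite opprB addrCA subrr addr0.
Qed.

Lemma hahn_mulA : associative hahn_mul.
Proof.
move=> f g h; apply: hahnP => c /=.
pose SA := [set a | f a != 0 /\ exists2 b, g b != 0 & h (c - a - b) != 0].
pose SX := [set x | (exists2 a, f a != 0 & g (x - a) != 0) /\ h (c - x) != 0].
have fA : finite_set SA.
  exact: wo_pair_finite (wo_supp f) (woD (wo_supp g) (wo_supp h)).
have fX : finite_set SX.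
  exact: wo_pair_finite (woD (wo_supp f) (wo_supp g)) (wo_supp h).
have inA a : (a \in (fset_set SA : seq R)) = (a \in SA) by rewrite in_fset_set.
have inX a : (a \in (fset_set SX : seq R)) = (a \in SX) by rewrite in_fset_set.
rewrite (@convE f (hahn_mul g h) c (fset_set SA)) ?fset_uniq //; last first.
  by move=> a fa /conv_neq0 [b gb hb]; rewrite inA inE; split=> //; exists b.
rewrite (@convE (hahn_mul f g) h c (fset_set SX)) ?fset_uniq //; last first.
  by move=> x /conv_neq0 [a fa ga] hx; rewrite inX inE; split=> //; exists a.
have L a : a \in (fset_set SA : seq R) -> f a * hahn_mul g h (c - a) =
    \sum_(x <- fset_set SX) f a * g (x - a) * h (c - x).
  rewrite inA inE => -[fa _] /=.
  rewrite (@convE g h (c - a) [seq x - a | x <- fset_set SX]).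
  - rewrite big_map big_distrr /=; apply: eq_bigr => x _; rewrite mulrA.
    by congr (_ * h _); rewrite opprB addrA subrK.
  - by rewrite map_inj_uniq ?fset_uniq // => x y /addIr.
  move=> b gb hb; apply/mapP; exists (a + b); last by rewrite addrC addKr.
  rewrite inX inE; split; last by rewrite opprD addrA.
  by exists a; rewrite // addrC addKr.
rewrite (eq_big_seq _ L) exchange_big /=; apply: eq_big_seq => x.
rewrite inX inE => -[_ hx].
rewrite (@convE f g x (fset_set SA)) ?fset_uniq //; last first.
  move=> a fa ga; rewrite inA inE; split=> //; exists (x - a) => //.
  by rewrite opprB addrA subrK.
by rewrite big_distrl.
Qed.

Definition hahn1 : K := hahn_mono 0 1.

Lemma hahn_monoE r x a : hahn_mono r x a = if a == r then x else 0.
Proof. by []. Qed.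

Lemma mono_conv r x f c : hahn_mul (hahn_mono r x) f c = x * f (c - r).
Proof.
rewrite /= (@convE (hahn_mono r x) f c [:: r]) //; last first.
  by move=> a; rewrite hahn_monoE inE; case: (a =P r) => // _; rewrite eqxx.
by rewrite big_seq1 hahn_monoE eqxx.
Qed.

Lemma hahn_mul1 : left_id hahn1 hahn_mul.
Proof. by move=> f; apply: hahnP => c; rewrite mono_conv mul1r subr0. Qed.

Lemma hahn_mulDl : left_distributive hahn_mul hahn_add.
Proof.
move=> f g h; apply: hahnP => c /=.
have [s us hs] := conv_seq f h c; have [s' us' hs'] := conv_seq g h c.
have u : uniq (undup (s ++ s')) by rewrite undup_uniq.
rewrite !(@convE _ h c _ u).
- by rewrite -big_split /=; apply: eq_bigr => a _; rewrite mulrDl.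
- by move=> a ga ha; rewrite mem_undup mem_cat hs' ?orbT.
- by move=> a ga ha; rewrite mem_undup mem_cat hs.
move=> a /= fga ha; rewrite mem_undup mem_cat.
case: (eqVneq (f a) 0) fga => [->|fa _]; last by rewrite hs.
by rewrite add0r => ga; rewrite hs' ?orbT.
Qed.

Lemma hahn1_neq0 : hahn1 != 0.
Proof.
apply/eqP => /(congr1 (fun f : K => f 0)) /eqP.
by rewrite hahn_monoE eqxx oner_eq0.
Qed.

HB.instance Definition _ := GRing.Zmodule_isComNzRing.Build K
  hahn_mulA hahn_mulC hahn_mul1 hahn_mulDl hahn1_neq0.

Lemma hcoef0 a : (0 : K) a = 0. Proof. by []. Qed.
Lemma hcoefD f g a : (f + g) a = f a + g a. Proof. by []. Qed.
Lemma hcoefN f a : (- f) a = - f a. Proof. by []. Qed.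
Lemma hcoefB f g a : (f - g) a = f a - g a. Proof. by []. Qed.
Lemma hcoef1 a : (1 : K) a = if a == 0 then 1 else 0. Proof. by []. Qed.
Lemma hcoefM f g a : (f * g) a = \sum_(b \in [set: R]) f b * g (a - b).
Proof. by []. Qed.
Lemma coef_monoM r x f c : (hahn_mono r x * f) c = x * f (c - r).
Proof. exact: mono_conv. Qed.

(* Geometric series: on a bounded range of exponents only finitely many powers
   of g contribute, since the exponents are real. *)
Section Geometric.
Variables (g : K) (d : R).
Hypotheses (d0 : 0 < d) (gd : forall a, g a != 0 -> d <= a).

Lemma coefX_lt n a : a < d *+ n -> (g ^+ n) a = 0.
Proof.
elim: n a => [|n IH] a.
  by rewrite mulr0n expr0 hcoef1 => /lt_eqF ->.
move=> an; apply/eqP/negP => /negP; rewrite exprS => /conv_neq0 [b gb].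
have db := gd gb; rewrite IH ?eqxx // ltrBlDr.
by apply: (lt_le_trans an); rewrite mulrSr lerD2l.
Qed.

Definition geo_bound (a : R) : nat := (Num.truncn (a / d)).+1.

Lemma geo_boundP a n : (geo_bound a <= n)%N -> a < d *+ n.
Proof.
move=> an; rewrite -mulr_natr mulrC -ltr_pdivrMr //.
by apply: (lt_le_trans (truncnS_gt _)); rewrite ler_nat.
Qed.

Definition geo_coef (a : R) : k := (\sum_(i < geo_bound a) g ^+ i : K) a.

Lemma hcoef_sum n (F : 'I_n -> K) a : (\sum_i F i) a = \sum_i F i a.
Proof.
elim: n F => [|n IH] F; first by rewrite !big_ord0.
by rewrite !big_ord_recl hcoefD IH.
Qed.

Lemma geo_coefE a n : (geo_bound a <= n)%N ->
  geo_coef a = (\sum_(i < n) g ^+ i : K) a.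
Proof.
move=> an; rewrite /geo_coef !hcoef_sum -(subnKC an) big_split_ord /=.
rewrite [X in _ + X]big1 ?addr0 // => i _.
by apply: coefX_lt; apply: geo_boundP; exact: leq_addr.
Qed.

Lemma geo_bound_le a b : a <= b -> (geo_bound a <= geo_bound b)%N.
Proof.
by move=> ab; rewrite ltnS le_truncn // ler_pdivrMr // divfK // gt_eqF.
Qed.

Lemma geo_wo : well_ordered [set a | geo_coef a != 0].
Proof.
move=> C CS [c Cc].
have [||b [Cb bc] bmin] :=
  @wo_supp R k (\sum_(i < geo_bound c) g ^+ i) (C `&` [set x | x <= c]).
- by move=> x [/CS /=] + xc; rewrite (geo_coefE (geo_bound_le xc)).
- by exists c; split => /=.
exists b => // x Cx; case: (leP x c) => xc; first exact: bmin.
exact: le_trans (ltW xc).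
Qed.

Lemma geo_inv : (1 - g) * Hahn geo_wo = 1.
Proof.
apply: hahnP => c.
have e1 a : a <= c -> (Hahn geo_wo) a = (\sum_(i < geo_bound c) g ^+ i : K) a.
  by move=> ac /=; apply: geo_coefE; apply: geo_bound_le.
have -> : ((1 - g) * Hahn geo_wo) c =
    ((1 - g) * \sum_(i < geo_bound c) g ^+ i) c.
  apply: eq_fsbigr => a _.
  case: (ltP a 0) => a0; last by rewrite e1 // lerBlDr lerDl.
  suff -> : (1 - g) a = 0 by rewrite !mul0r.
  rewrite hcoefB hcoef1 lt_eqF // sub0r; apply/eqP; rewrite oppr_eq0.
  by apply/negP => /negP /gd da; have := lt_trans d0 (le_lt_trans da a0); rewrite ltxx.
have -> : (1 - g) * (\sum_(i < geo_bound c) g ^+ i) = 1 - g ^+ geo_bound c.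
  by apply/eqP; rewrite -eqr_opp -mulNr !opprB -subrX1.
by rewrite hcoefB (coefX_lt (geo_boundP (leqnn _))) subr0.
Qed.

End Geometric.

(* Meaningful for f != 0 only: [hval 0] is the junk value inf set0 = 0, so the
   convention val 0 = +oo is replaced by explicit restrictions to nonzero
   series. *)
Definition hval f : R := inf [set a | f a != 0].

Lemma hvalP f : f != 0 -> f (hval f) != 0 /\ forall a, f a != 0 -> hval f <= a.
Proof.
move=> f0.
have [||b fb bmin] := wo_supp f [set a | f a != 0] => //.
  apply/set0P; apply: contra f0 => /eqP e; apply/eqP/hahnP => a; rewrite hcoef0.
  apply/eqP; rewrite -[_ == _]negbK; apply/negP => fa.
  by have : [set a | f a != 0] a by []; rewrite e.
suff -> : hval f = b by [].
apply/eqP; rewrite eq_le; apply/andP; split.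
  by apply: ge_inf => //; exists b => x; apply: bmin.
by apply: lb_le_inf; [exists b|move=> x; apply: bmin].
Qed.

Lemma hahn_has_inv f : f != 0 -> exists g, g * f = 1.
Proof.
move=> f0; have [fv vmin] := hvalP f0; set v := hval f in fv vmin.
pose g : K := 1 - hahn_mono (- v) (f v)^-1 * f.
have gpos a : g a != 0 -> 0 < a.
  rewrite hcoefB hcoef1 coef_monoM opprK; case: (eqVneq a 0) => [->|a0].
    by rewrite add0r mulVf // subrr eqxx.
  rewrite sub0r oppr_eq0 mulf_eq0 negb_or => /andP[_ /vmin].
  by rewrite lerDr lt_neqAle eq_sym a0.
have [d d0 gd] : exists2 d, 0 < d & forall a, g a != 0 -> d <= a.
  have [->|g0] := eqVneq g 0.
    by exists 1; rewrite ?ltr01 // => a; rewrite hcoef0 eqxx.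
  by have [gv gmin] := hvalP g0; exists (hval g) => //; apply: gpos.
exists (hahn_mono (- v) (f v)^-1 * Hahn (geo_wo d0 gd)).
by rewrite mulrAC -[X in X * _](subKr 1) -/g geo_inv.
Qed.

Definition hahn_inv f : K := xget 0 [set g | f != 0 /\ g * f = 1].

Lemma hahn_mulVf f : f != 0 -> hahn_inv f * f = 1.
Proof.
move=> f0; have [g gf] := hahn_has_inv f0.
by have [] := @xgetPex _ 0 [set g | f != 0 /\ g * f = 1] (ex_intro _ g (conj f0 gf)).
Qed.

Lemma hahn_inv0 : hahn_inv 0 = 0.
Proof. by apply: xgetPN => g /= []; rewrite eqxx. Qed.

HB.instance Definition _ := GRing.ComNzRing_isField.Build K hahn_mulVf hahn_inv0.

Definition tpow (r : R) : K := hahn_mono r 1.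
Definition hahnC (x : k) : K := hahn_mono 0 x.

Lemma hahnC_zmod : zmod_morphism hahnC.
Proof.
by move=> x y; apply: hahnP => a; rewrite hcoefB !hahn_monoE; case: ifP; rewrite ?subr0.
Qed.
Lemma hahnC_monoid : monoid_morphism hahnC.
Proof.
split=> // x y; apply: hahnP => a.
by rewrite coef_monoM !hahn_monoE subr0; case: ifP; rewrite ?mulr0.
Qed.
HB.instance Definition _ := GRing.isZmodMorphism.Build k K hahnC hahnC_zmod.
HB.instance Definition _ := GRing.isMonoidMorphism.Build k K hahnC hahnC_monoid.

(* Reduction to the residue field; meaningful on the valuation ring. *)
Definition residue f : k := f 0.
Definition hlead f : k := residue (tpow (- hval f) * f).

Lemma hleadE f : hlead f = f (hval f).
Proof. by rewrite /hlead /residue coef_monoM mul1r opprK add0r. Qed.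

End HahnRing.

Local Close Scope classical_set_scope.
Local Open Scope set_scope.
Local Open Scope ring_scope.

Section Ideals.
Variable A : comNzRingType.
Implicit Types (S G : set A).

(* For S a subring: the ideal of S generated by a subset G of S. *)
Definition ideal_span S G : set A := fun z =>
  exists r : seq (A * A),
    (forall p, p \in r -> S p.1 /\ G p.2) /\ z = \sum_(p <- r) p.1 * p.2.

End Ideals.

Local Notation "x %:F" := (@FracField.tofrac _ x).

Section Laurent.
Variables (k : fieldType) (N : nat).
Implicit Types (V : pred 'I_N) (I : set {mpoly k[N]}).

(* The polynomial ring in the variables selected by V. *)
Definition polys_in V : set {mpoly k[N]} := fun f =>
  forall m i, m \in msupp f -> m i != 0%N -> V i.

(* The Laurent polynomial ring in the variables selected by V, as a subring of
   the field of rational functions. *)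
Definition laurent V : set {fraction {mpoly k[N]}} := fun z =>
  exists (f : {mpoly k[N]}) (m : 'X_{1..N}),
    [/\ polys_in V f, forall i, m i != 0%N -> V i & z = f%:F / ('X_[m])%:F].

Definition laurent_ext V I : set {fraction {mpoly k[N]}} :=
  ideal_span (laurent V) (fun z => exists2 f, I f & z = f%:F).

Definition laurent_unit V I : Prop := laurent_ext V I 1.

(* The ideal of the closure in affine N-space of the closed subscheme of the
   torus cut out by I. *)
Definition torus_closure I : set {mpoly k[N]} := fun f =>
  laurent_ext xpredT I f%:F.

End Laurent.

Section InitialForms.
Variables (R : realType) (k : fieldType) (N : nat).

Definition weight (v : 'I_N -> R) (m : 'X_{1..N}) : R := \sum_i v i *+ m i.

Definition init (w : 'I_N -> R) (f : {mpoly k[N]}) : {mpoly k[N]} :=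
  \sum_(m <- msupp f |
         all (fun m' => weight w m <= weight w m') (msupp f)) f@_m *: 'X_[m].

Definition vweight (v : 'I_N -> R) (f : {mpoly (hahn R k)[N]}) m : R :=
  hval f@_m + weight v m.

Definition vinit (v : 'I_N -> R) (f : {mpoly (hahn R k)[N]}) : {mpoly k[N]} :=
  \sum_(m <- msupp f |
         all (fun m' => vweight v f m <= vweight v f m') (msupp f))
     hlead f@_m *: 'X_[m].

End InitialForms.

(* Expansion along the first row. *)
Fixpoint pfaffian (L : comNzRingType) (m : nat) : 'M[L]_m -> L :=
  match m with
  | 0 => fun=> 1
  | 1 => fun=> 0
  | m'.+2 => fun X => \sum_(j < m'.+1) (-1) ^+ j * X ord0 (lift ord0 j) *
      pfaffian (mxsub (fun i => lift ord0 (lift j i))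
                      (fun i => lift ord0 (lift j i)) X)
  end.

Section Spinor.
Variables (L : fieldType) (n : nat).
Implicit Types (A : 'M[L]_(n, n + n)) (lam mu : {set 'I_n}).

(* A subspace F of L^(2n) is given by a matrix with row space F; column
   [lshift n i] is the coordinate y_i and column [rshift n i] is y_(i^* ). *)

Definition quadQ : 'M[L]_(n + n) := block_mx 0 1%:M 1%:M 0.

Definition totally_isotropic A : Prop :=
  \rank A = n /\
  forall x y : 'rV[L]_(n + n), (x <= A)%MS -> (y <= A)%MS ->
    x *m quadQ *m y^T = 0.

(* The Pluecker coordinate p of lam together with the i^*, i \notin lam. The
   columns are listed as i = 0, ..., n-1, which may change its sign but not its
   vanishing. *)
Definition bar lam (i : 'I_n) : 'I_(n + n) :=
  if i \in lam then lshift n i else rshift n i.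
Definition pluckerbar A lam : L := \det (colsub (bar lam) A).

Definition delta_matroid_of A : {set {set 'I_n}} :=
  [set lam | pluckerbar A lam != 0].

Definition in_spinor A : Prop :=
  totally_isotropic A /\
  forall lam, odd (n - #|lam|) -> pluckerbar A lam = 0.

Definition lin_ideal A : set {mpoly L[n + n]} := fun f =>
  forall x : 'rV[L]_(n + n), (x <= A)%MS -> f.@[fun i => x 0 i] = 0.

Definition evens : {set {set 'I_n}} := [set lam : {set 'I_n} | ~~ odd (n - #|lam|)].

Definition principal (X : 'M[L]_n) mu : 'M[L]_#|mu| :=
  mxsub enum_val enum_val X.

Definition wick (X : 'M[L]_n) lam : L := pfaffian (principal X (~: lam)).

(* A vector indexed by evens is represented by a function on {set 'I_n}, of
   which only the values on evens are used. *)
Definition graph_coord A (q : {set 'I_n} -> L) :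
    'I_(n * (n + n) + #|evens|) -> L :=
  fun i => match split i with
           | inl j => mxvec A 0 j
           | inr l => q (enum_val l)
           end.

(* [q] is a vector of homogeneous coordinates of the image under the Wick
   embedding of the row space of [A]. The formula [wick] only applies on the
   dense open cell of subspaces rowspan [I | X]; the embedding is its unique
   extension to a morphism on the whole (irreducible, projective) spinor
   variety, whose graph is the Zariski closure of the graph over that cell.
   Both members of a pair of the graph are given by arbitrary representatives,
   whence G and s. *)
Definition wick_vector A (q : {set 'I_n} -> L) : Prop :=
  [/\ in_spinor A,
      exists2 lam, lam \in evens & q lam != 0 &
      forall P : {mpoly L[n * (n + n) + #|evens|]},
        (forall (G : 'M[L]_n) (X : 'M[L]_n) (s : L),
           G \in unitmx -> X^T = - X -> s != 0 ->
           P.@[graph_coord (G *m row_mx 1%:M X) (fun lam => s * wick X lam)]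
             = 0) ->
        P.@[graph_coord A q] = 0].

Definition qeval (f : {mpoly L[#|evens|]}) (q : {set 'I_n} -> L) : L :=
  f.@[fun i => q (enum_val i)].

(* The homogeneous ideal, as the ideal of the affine cone ([wick_vector A] is
   stable under nonzero scalars). *)
Definition spinor_ideal : set {mpoly L[#|evens|]} := fun f =>
  forall A q, wick_vector A q -> qeval f q = 0.

End Spinor.

Definition symdiff (T : finType) (X Y : {set T}) : {set T} :=
  (X :\: Y) :|: (Y :\: X).

Definition even_delta_matroid n (B : {set {set 'I_n}}) : Prop :=
  [/\ exists mu, mu \in B,
      forall mu nu, mu \in B -> nu \in B -> ~~ odd #|symdiff mu nu| &
      forall mu nu i, mu \in B -> nu \in B -> i \in symdiff mu nu ->
        exists2 j, j \in symdiff mu nu & symdiff mu [set i; j] \in B].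

(* The bases of M_u^w. *)
Definition initial_matroid (R : realType) n (B : {set {set 'I_n}})
    (w : {set 'I_n} -> R) (u : 'I_n -> R) : {set {set 'I_n}} :=
  [set lam in B | [forall mu in B,
     w lam + \sum_(i in lam) u i <= w mu + \sum_(i in mu) u i]].

Section Stratum.
Variables (R : realType) (k : fieldType) (n : nat) (B : {set {set 'I_n}}).
Implicit Types (w : {set 'I_n} -> R).

Local Notation Kq := {mpoly k[#|evens n|]}.

Definition qvar_in (i : 'I_#|evens n|) : bool := enum_val i \in B.

(* B_M, as a subring of the polynomial ring in all the q_lam, lam \in evens. *)
Definition BM : set Kq := polys_in qvar_in.

Definition IM : set Kq := fun f =>
  BM f /\
  exists g h : Kq,
    [/\ ideal_span setT (fun z => exists2 i, ~~ qvar_in i & z = 'X_i) g,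
        spinor_ideal h & f = g + h].

Definition in_IM w : set Kq :=
  ideal_span BM (fun z => exists2 f, IM f & z = init (fun i => w (enum_val i)) f).

(* Elements of R^B / R(1,...,1) are given by representatives; values of w off B
   are not used. *)
Definition trop_SM w : Prop := ~ laurent_unit qvar_in (in_IM w).

(* Homogeneous coordinates, extended by 0 off B, of a point of the dense torus
   of P(L^B). *)
Definition torus_point (L : fieldType) (x : {set 'I_n} -> L) : Prop :=
  forall lam, (x lam != 0) = (lam \in B).

Definition k_point_in_SM w (x : {set 'I_n} -> k) : Prop :=
  torus_point x /\ forall f, in_IM w f -> qeval f x = 0.

Definition K_point_SM (q : {set 'I_n} -> hahn R k) : Prop :=
  torus_point q /\
  forall f, IM f -> qeval (map_mpoly (@hahnC R k) f) q = 0.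

(* q, w and x are only defined up to a nonzero scalar of hahn R k, an additive
   constant and a nonzero scalar of k respectively. *)
Definition exploded_trop w (x : {set 'I_n} -> k)
    (q : {set 'I_n} -> hahn R k) : Prop :=
  exists (c : R) (d : k), d != 0 /\
    forall lam, lam \in B -> hval (q lam) = w lam + c /\ hlead (q lam) = d * x lam.

End Stratum.

Section InitialSpace.
Variables (R : realType) (k : fieldType) (n : nat).
Implicit Types (F : 'M[hahn R k]_(n, n + n)) (v : 'I_(n + n) -> R).

Definition in_lin_ideal F v : set {mpoly k[n + n]} :=
  ideal_span setT (fun z => exists2 f, lin_ideal F f & z = vinit v f).

Definition trop_lin F v : Prop := ~ laurent_unit xpredT (in_lin_ideal F v).

Definition minus_plus (u : 'I_n -> R) : 'I_(n + n) -> R :=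
  fun i => match split i with inl j => - u j | inr j => u j end.

End InitialSpace.

(* Main.v *)
(** Rescaling the coordinates of F by t^u and t^-u preserves the quadratic form
    and turns the initial ideal into the ideal of the reduction F0 of an
    integral echelon basis, which exists by Cramer's rule once a maximal minor
    of least valuation is inverted; integral linear forms lift, so nothing is
    lost.  Isotropy passes to the residue field.  Since det = Pf^2, the
    Pluecker coordinates of F are, up to a common factor, the squares of its
    Wick coordinates, so after rescaling they have valuation
    2 (w_lam + <u, e_lam>) + C.  All of them are integral, and some coordinate
    of F0 is nonzero because every Lagrangian subspace is transversal to a
    coordinate Lagrangian: hence the minimum of the valuations is 0, and the
    bases of F0 are the minimizers. *)

Require Import Defs.
From HB Require Import structures.
From mathcomp Require Import all_boot all_order all_algebra.
From mathcomp Require Import fraction.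
From mathcomp Require Import boolp classical_sets reals.
From mathcomp Require Import mpoly ring lra zify.

Set Implicit Arguments.
Unset Strict Implicit.
Unset Printing Implicit Defensive.

Import Order.TTheory GRing.Theory Num.Theory.

Local Open Scope ring_scope.

(** * Pfaffians of lists as iterated alternating sums *)

Section PfaffianSequence.
Variables (L : comNzRingType) (T : Type).
Implicit Types (s t : seq T) (h : T -> seq T -> L).

(* The alternating sum of h (s_j) (s without s_j) over the positions j of s. *)
Fixpoint altsum h s : L :=
  if s is x :: s' then h x s' - altsum (fun y t => h y (x :: t)) s' else 0.

Lemma eq_altsum h1 h2 s :
  (forall y t, (size t).+1 = size s -> h1 y t = h2 y t) ->
  altsum h1 s = altsum h2 s.
Proof.
elim: s h1 h2 => [//|x s IH] h1 h2 H /=.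
by rewrite H //; congr (_ - _); apply: IH => y t /= e; apply: H; rewrite /= e.
Qed.

Lemma altsumN h s : altsum (fun y t => - h y t) s = - altsum h s.
Proof. by elim: s h => [|x s IH] h /=; rewrite ?oppr0 // IH opprD. Qed.

Lemma altsumB h1 h2 s :
  altsum (fun y t => h1 y t - h2 y t) s = altsum h1 s - altsum h2 s.
Proof.
elim: s h1 h2 => [|x s IH] h1 h2 /=; first by rewrite subr0.
by rewrite IH !opprD !opprK addrACA.
Qed.

Lemma altsumZ c h s : altsum (fun y t => c * h y t) s = c * altsum h s.
Proof. by elim: s h => [|x s IH] h /=; rewrite ?mulr0 // IH mulrBr. Qed.

Lemma altsum_swap h s1 a b s2 :
  (forall y t1 t2, (size t1 + size t2).+1 = size s1 + size s2 ->
     h y (t1 ++ a :: b :: t2) = - h y (t1 ++ b :: a :: t2)) ->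
  altsum h (s1 ++ a :: b :: s2) = - altsum h (s1 ++ b :: a :: s2).
Proof.
elim: s1 h => [|x s1 IH] h H /=; last first.
  rewrite IH; last first.
    by move=> y t1 t2 sz; rewrite -!cat_cons H //= !addSn sz.
  by rewrite H //; ring.
have -> : altsum (fun y t => h y (a :: b :: t)) s2 =
          - altsum (fun y t => h y (b :: a :: t)) s2.
  by rewrite -altsumN; apply: eq_altsum => y t sz; rewrite (H y [::]).
by ring.
Qed.

(* Both arguments are drawn from s, so exchanging their roles reverses every
   sign. *)
Lemma altsum2_flip (g : T -> T -> seq T -> L) s :
  altsum (fun y => altsum (fun z => g y z)) s =
  - altsum (fun y => altsum (fun z => g z y)) s.
Proof.
elim: s g => [|x s IH] g /=; first by rewrite oppr0.
have E (g' : T -> T -> seq T -> L) :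
    altsum (fun y t => g' y x t - altsum (fun z t0 => g' y z (x :: t0)) t) s =
    altsum (fun y => g' y x) s -
    altsum (fun y => altsum (fun z t => g' y z (x :: t))) s.
  exact: altsumB.
rewrite (E g) (E (fun y z => g z y)) (IH (fun y z t => g y z (x :: t))).
by ring.
Qed.

Variable f : T -> T -> L.

(* The Pfaffian of (f x y)_(x, y in s), for s of size d.*2. *)
Fixpoint pfs (d : nat) s : L :=
  if d is d'.+1 then
    if s is x :: s' then altsum (fun y t => f x y * pfs d' t) s' else 0
  else 1.

Hypothesis fN : forall x y, f x y = - f y x.

(** Either [x] is paired with [y], or [y] heads the remaining list and is expanded in turn. For
    [d = 0] the double sum is empty, so the truncated [d.-1] is harmless. *)
Lemma pfsS d x y s : (size s = d.*2) ->
  pfs d.+1 (x :: y :: s) = f x y * pfs d s -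
    altsum (fun z => altsum (fun z' t => f x z * f y z' * pfs d.-1 t)) s.
Proof.
case: d => [/size0nil ->|d _] //.
rewrite [LHS]/=; congr (_ - _); apply: eq_altsum => z t _ .
by rewrite -altsumZ; apply: eq_altsum => ? ? _; rewrite mulrA.
Qed.

(** A swap behind the first entry acts on the terms of the expansion, by induction and
    [altsum_swap]; a swap of the first two entries is read off from [pfsS]. *)
Lemma pfs_swap d s1 a b s2 : size (s1 ++ a :: b :: s2) = d.*2 ->
  pfs d (s1 ++ a :: b :: s2) = - pfs d (s1 ++ b :: a :: s2).
Proof.
elim: d s1 a b s2 => [|d IH] s1 a b s2; first by rewrite size_cat /= !addnS.
case: s1 => [|x s1] sz; last first.
  apply: altsum_swap => y t1 t2 szt; rewrite -mulrN; congr (_ * _); apply: IH.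
  by move: sz; rewrite !size_cat /=; lia.
have {}sz : size s2 = d.*2 by move: sz => /=; lia.
rewrite !cat0s !pfsS //.
(* The term pairing [a] with [b] changes sign by skew symmetry of [f], the double sum by exchanging
   the order of drawing. *)
rewrite altsum2_flip fN mulNr opprB opprK addrC; congr (_ - _).
by apply: eq_altsum => z t _; apply: eq_altsum => z' t' _; rewrite [f a _ * _]mulrC.
Qed.

Hypothesis two_regular : forall z : L, z = - z -> z = 0.

(** Adjacent swaps bring the two copies of [x] together, where one more swap fixes the list but
    reverses the sign. *)
Lemma pfs_dup d x s0 s1 s2 : size (s0 ++ x :: s1 ++ x :: s2) = d.*2 ->
  pfs d (s0 ++ x :: s1 ++ x :: s2) = 0.
Proof.
elim: s1 s0 => [|y s1 IH] s0 sz; first exact/two_regular/pfs_swap.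
rewrite pfs_swap // -cat_rcons IH ?oppr0 // -sz -cat_rcons.
by rewrite !size_cat !size_rcons /= !size_cat /= !addSnnS.
Qed.

End PfaffianSequence.

Lemma altsum_enum (L : comNzRingType) (T : Type) m (g : 'I_m.+1 -> T)
    (h : T -> seq T -> L) :
  altsum h (map g (enum 'I_m.+1)) =
  \sum_(j < m.+1) (-1) ^+ j * h (g j) [seq g (lift j i) | i <- enum 'I_m].
Proof.
elim: m g h => [|m IH] g h; rewrite enum_ordSl /= -map_comp big_ord_recl mul1r.
  by rewrite enum_ord0 big_ord0 subr0 addr0.
rewrite IH -sumrN; congr (_ + _); apply: eq_bigr => j _.
rewrite lift0 exprS mulN1r mulNr; congr (- (_ * h _ _)).
rewrite enum_ordSl /= -map_comp; congr (_ :: _).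
  by congr (g _); apply: val_inj.
by apply: eq_map => i; congr (g _); apply: val_inj; rewrite /= /bump; lia.
Qed.

(** On lists, the nested submatrices of [pfaffian] become sublists, to which the sign rules above
    apply. *)
Lemma pfaffian_pfs (L : comNzRingType) (T : Type) (f : T -> T -> L) m d
    (g : 'I_m -> T) : m = d.*2 ->
  pfaffian (\matrix_(i, j) f (g i) (g j)) = pfs f d (map g (enum 'I_m)).
Proof.
elim: d m g => [|d IH] [|[|m]] g // [md].
rewrite enum_ordSl /= -map_comp altsum_enum.
apply: eq_bigr => j _; rewrite mxE mulrA; congr (_ * _ * _).
rewrite -IH //; congr pfaffian.
by apply/matrixP => i i'; rewrite !mxE.
Qed.

(** * Cofactors of singular matrices and bordered determinants *)

Lemma left_kernel_cofactor (L : fieldType) m (Y : 'M[L]_m) i j (u v : 'rV[L]_m) :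
  cofactor Y i j != 0 -> u *m Y = 0 -> v *m Y = 0 -> v 0 i != 0 ->
  u = (u 0 i / v 0 i) *: v.
Proof.
move=> c0 uY vY vi; apply/eqP; rewrite -subr_eq0; apply/eqP.
(* The kernel is at most a line: [z] lies in it and vanishes at [i], and its other entries are
   killed by the invertible minor. *)
set z := u - _; have zY : z *m Y = 0 by rewrite mulmxBl uY -scalemxAl vY scaler0 subr0.
have zi : z 0 i = 0 by rewrite !mxE divfK // subrr.
move: z zY zi => {u uY v vY vi} z zY zi.
case: m Y i j c0 z zY zi => [|m] Y i j c0 z zY zi; first by case: i {c0 zi}.
have uM : row' i (col' j Y) \in unitmx.
  rewrite unitmxE unitfE; move: c0; rewrite /cofactor mulf_eq0 negb_or.
  by case/andP.
have /mulmxK : row' i (col' j Y) \in unitmx by [].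
move=> /(_ _ (col' i z)).
have -> : col' i z *m row' i (col' j Y) = 0.
  apply/rowP => k; have /rowP/(_ (lift j k)) := zY.
  rewrite !mxE (bigD1_ord i) //= zi mul0r add0r => zk; rewrite -[RHS]zk.
  by apply: eq_bigr => l _; rewrite !mxE.
rewrite mul0mx => /rowP z0; apply/rowP => l.
by case: (unliftP i l) => [l'|] ->; [have := z0 l'; rewrite !mxE | rewrite zi mxE].
Qed.

(** The rows of the adjugate lie in the left kernel. If some cofactor is nonzero, this kernel is a
    line, so the adjugate has rank one; symmetry and the diagonal then fix it. Otherwise the
    diagonal forces [p = 0]. *)
Lemma cofactor_outer (L : fieldType) m (Y : 'M[L]_m) (p : 'rV[L]_m) :
  \det Y = 0 -> p *m Y = 0 ->
  (forall i j, cofactor Y i j = cofactor Y j i) ->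
  (forall i, cofactor Y i i = p 0 i ^+ 2) ->
  forall i j, cofactor Y i j = p 0 i * p 0 j.
Proof.
move=> dY pY sym diag i j.
have [[i0 [j0 c0]]|H] := pselect (exists i j, cofactor Y i j != 0); last first.
  have C0 i' j' : cofactor Y i' j' = 0.
    by apply/eqP; apply: contrapT => /negP ?; apply: H; exists i', j'.
  by have /eqP := diag i; rewrite !C0 eq_sym sqrf_eq0 => /eqP ->; rewrite mul0r.
have aY l : row l (\adj Y) *m Y = 0.
  by rewrite -row_mul mul_adj_mx dY; apply/rowP => k; rewrite !mxE mul0rn.
pose v := row j0 (\adj Y).
have vi : v 0 i0 != 0 by rewrite !mxE.
have cE l k : cofactor Y k l = cofactor Y i0 l / v 0 i0 * v 0 k.
  have /rowP/(_ k) := left_kernel_cofactor c0 (aY l) (aY j0) vi.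
  by rewrite !mxE.
have pE k : p 0 k = p 0 i0 / v 0 i0 * v 0 k.
  by rewrite {1}(left_kernel_cofactor c0 pY (aY j0) vi) mxE.
have e0 : cofactor Y i0 i0 = p 0 i0 ^+ 2 by [].
rewrite (cE j i) sym (cE i0 j) e0 (pE i) (pE j).
by field.
Qed.

Lemma det_skew_odd (L : fieldType) m (Y : 'M[L]_m) : 2%:R != 0 :> L ->
  Y^T = - Y -> odd m -> \det Y = 0.
Proof.
move=> two sk om; have := det_tr Y; rewrite sk -scaleN1r detZ -signr_odd om.
rewrite expr1 mulN1r => /eqP; rewrite eq_sym -addr_eq0 -mulr2n -mulr_natl.
by rewrite mulf_eq0 (negPf two) => /eqP.
Qed.

(** Cauchy's expansion: along the first row, then along the first column of each minor. The zero
    corner removes the one remaining term. *)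
Lemma det_bordered (L : comNzRingType) m (X : 'M[L]_m.+2) :
  X ord0 ord0 = 0 ->
  \det X = - \sum_i \sum_j X (lift ord0 i) ord0 * X ord0 (lift ord0 j) *
             cofactor (row' ord0 (col' ord0 X)) i j.
Proof.
move=> x00; rewrite (expand_det_row _ ord0) big_ord_recl x00 mul0r add0r.
rewrite exchange_big -sumrN; apply: eq_bigr => j _ /=.
rewrite /cofactor (expand_det_col _ ord0) !big_distrr -sumrN.
apply: eq_bigr => i _ /=; rewrite !mxE /cofactor.
rewrite add0n [bump 0 j]/= exprS addn0.
have -> : lift (lift ord0 j) ord0 = ord0 :> 'I_m.+2 by apply: val_inj.
have -> : row' i (col' ord0 (row' ord0 (col' (lift ord0 j) X))) =
          row' i (col' j (row' ord0 (col' ord0 X))).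
  apply/matrixP => a b; rewrite !mxE; congr (X _ _); apply: val_inj.
  by rewrite /= /bump; lia.
by rewrite exprD; ring.
Qed.

(** * The determinant of a skew-symmetric matrix is the square of its Pfaffian *)

Section PfaffianSquare.
Variable L : fieldType.
Hypothesis two : 2%:R != 0 :> L.

Lemma eq_opp_eq0 (z : L) : z = - z -> z = 0.
Proof.
move=> /eqP; rewrite -addr_eq0 -mulr2n -mulr_natl mulf_eq0 (negPf two).
by move/eqP.
Qed.

(* Expanding the Pfaffian of Y bordered with a copy of its row i gives the i-th
   entry of the product. *)
Lemma skew_mul_subpfaffians d m (Y : 'M[L]_m) : Y^T = - Y -> m = d.*2.+1 ->
  (\row_(j < m) ((-1) ^+ j * pfaffian (row' j (col' j Y)))) *m Y = 0.
Proof.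
move=> sk md; case: m Y sk md => // m Y sk [md].
have YN a b : Y a b = - Y b a by have /matrixP/(_ b a) := sk; rewrite !mxE.
apply/rowP => i; rewrite !mxE.
have sz : size (enum 'I_m.+1) = d.*2.+1 by rewrite -cardE card_ord md.
(* The index [i] occurs twice in this list, so [pfs_dup] applies. *)
have : pfs (fun a b => Y a b) d.+1 (i :: enum 'I_m.+1) = 0.
  have /splitPr : i \in enum 'I_m.+1 by rewrite mem_enum.
  move: sz => /[swap] -[s1 s2] sz.
  by apply: (pfs_dup YN eq_opp_eq0 (s0 := [::])); rewrite /= sz.
have -> : enum 'I_m.+1 = map id (enum 'I_m.+1) by rewrite map_id.
rewrite /= altsum_enum => /eqP; rewrite -oppr_eq0 -sumrN => /eqP sum0; rewrite -[RHS]sum0.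
apply: eq_bigr => j _; rewrite mxE -pfaffian_pfs //.
have -> : row' j (col' j Y) = \matrix_(a, b) Y (lift j a) (lift j b).
  by apply/matrixP => a b; rewrite !mxE.
by rewrite (YN j i); ring.
Qed.

(** Removing the first row and column leaves a singular matrix [Y] of odd size, whose kernel
    contains the vector [p] of signed sub-Pfaffians. By induction its diagonal cofactors are the
    squares of the entries of [p], so its cofactors are [p 0 i * p 0 j] and the bordered expansion
    becomes the square of the expansion of the Pfaffian. *)
Lemma det_pfaffian m (X : 'M[L]_m) : X^T = - X -> ~~ odd m ->
  \det X = pfaffian X ^+ 2.
Proof.
(* Induction on a bound, since the sub-Pfaffians have size smaller by two. *)
move: {2}m (leqnn m) => N; elim: N m X => [|N IH] [|[|m]] X //.
- by rewrite det_mx00 expr1n.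
- by rewrite det_mx00 expr1n.
rewrite !ltnS => mN sk; rewrite [odd _]/= negbK => em.
have XN a b : X a b = - X b a by have /matrixP/(_ b a) := sk; rewrite !mxE.
have x00 : X ord0 ord0 = 0 by apply: eq_opp_eq0; apply: XN.
pose Y := row' ord0 (col' ord0 X).
have skY : Y^T = - Y by apply/matrixP => a b; rewrite !mxE XN.
pose p : 'rV[L]_m.+1 := \row_j ((-1) ^+ j * pfaffian (row' j (col' j Y))).
have cE : forall i j, cofactor Y i j = p 0 i * p 0 j.
  apply: cofactor_outer.
  - by apply: det_skew_odd => //=; rewrite em.
  - apply: (@skew_mul_subpfaffians m./2) => //.
    by rewrite -[in LHS](odd_double_half m) (negPf em).
  - move=> i j; rewrite -cofactor_tr skY -scaleN1r cofactorZ /=.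
    by rewrite -signr_odd (negPf em) mul1r.
  - move=> i; rewrite /cofactor mxE exprMn -exprM muln2 -addnn; congr (_ * _).
    apply: IH => //; first exact: ltnW.
    by apply/matrixP => a b; have /matrixP/(_ (lift i b) (lift i a)) := skY; rewrite !mxE.
rewrite det_bordered // -/Y.
have -> : pfaffian X = \sum_j X ord0 (lift ord0 j) * p 0 j.
  apply: eq_bigr => j _; rewrite mxE mulrCA mulrA; congr (_ * _ * pfaffian _).
  by apply/matrixP => a b; rewrite !mxE.
rewrite expr2 big_distrl -sumrN; apply: eq_bigr => i _ /=.
rewrite big_distrr -sumrN; apply: eq_bigr => j _ /=.
by rewrite cE (XN (lift ord0 i)); ring.
Qed.
End PfaffianSquare.

(** * Pluecker coordinates and squares of Wick coordinates *)

Lemma det_1addmul_comm (L : comNzRingType) m p (A : 'M[L]_(m, p))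
    (B : 'M[L]_(p, m)) :
  \det (1%:M + A *m B) = \det (1%:M + B *m A).
Proof.
(* Sylvester's identity: the same two block matrices, multiplied in either order, give block
   triangular products, one for each side. *)
have e : block_mx 1%:M (- A) B 1%:M *m block_mx 1%:M A 0 1%:M =
         block_mx 1%:M 0 B (1%:M + B *m A).
  by rewrite mulmx_block !mulmx1 !mulmx0 !mul1mx !addr0 subrr addrC.
have e' : block_mx 1%:M A 0 1%:M *m block_mx 1%:M (- A) B 1%:M =
          block_mx (1%:M + A *m B) 0 B 1%:M.
  by rewrite mulmx_block !mulmx1 !mul1mx !mul0mx !add0r addNr.
have := det_mulmx (block_mx 1%:M (- A) B 1%:M) (block_mx 1%:M A 0 1%:M).
rewrite mulrC -det_mulmx e e' !det_lblock !det1 mul1r mulr1.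
by move=> ->.
Qed.

Section Plucker.
Variables (L : fieldType) (n : nat).
Implicit Types (A : 'M[L]_(n, n + n)) (lam mu : {set 'I_n}).

Lemma pluckerbar_mull (G : 'M[L]_n) A lam :
  pluckerbar (G *m A) lam = \det G * pluckerbar A lam.
Proof. by rewrite /pluckerbar -det_mulmx mulmx_colsub. Qed.

(** The selected columns differ from the identity only outside [lam], by a correction that factors
    through [~: lam]; Sylvester's identity turns the determinant into a principal minor. *)
Lemma pluckerbar_graph (X : 'M[L]_n) lam :
  pluckerbar (row_mx 1%:M X) lam = \det (principal X (~: lam)).
Proof.
set ev := @enum_val _ (mem (~: lam)).
transitivity (\det (1%:M + colsub ev (X - 1%:M) *m rowsub ev 1%:M)).
  congr (\det _); apply/matrixP => i j; rewrite [LHS]mxE [RHS]mxE [X in _ + X]mxE /bar.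
  case: ifPn => jl.
    rewrite row_mxEl big1 ?addr0 // => a _; rewrite !mxE.
    have := enum_valP a; rewrite finset.in_setC -/ev.
    by have [->|_] := eqVneq (ev a) j; rewrite ?jl ?mulr0.
  have jl' : j \in ~: lam by rewrite finset.in_setC.
  rewrite row_mxEr (bigD1 (enum_rank_in jl' j)) //= big1 => [|a].
    by rewrite !mxE /ev enum_rankK_in // eqxx mulr1 addr0 addrC subrK.
  rewrite !mxE => ne; have [e|_] := eqVneq (ev a) j; rewrite ?mulr0 //.
  by case/eqP: ne; apply: enum_val_inj; rewrite enum_rankK_in.
rewrite det_1addmul_comm mul_rowsub_mx mul1mx; congr (\det _).
apply/matrixP => a b; rewrite !mxE (inj_eq enum_val_inj).
by rewrite addrC subrK.
Qed.

Hypothesis two : 2%:R != 0 :> L.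

Lemma wick_sqr (X : 'M[L]_n) lam : X^T = - X -> lam \in evens n ->
  wick X lam ^+ 2 = pluckerbar (row_mx 1%:M X) lam.
Proof.
move=> sk; rewrite finset.in_set => el; rewrite pluckerbar_graph -det_pfaffian //.
  by apply/matrixP => a b; have /matrixP/(_ (enum_val a) (enum_val b)) := sk; rewrite !mxE.
by rewrite cardsCs finset.setCK card_ord.
Qed.

Lemma graph_coordl A q i j :
  graph_coord A q (lshift _ (mxvec_index i j)) = A i j.
Proof.
rewrite /graph_coord -[lshift _ _]/(unsplit (inl _)) unsplitK.
by rewrite mxvecE.
Qed.

Lemma graph_coordr A q lam (el : lam \in evens n) :
  graph_coord A q (rshift _ (enum_rank_in el lam)) = q lam.
Proof.
rewrite /graph_coord -[rshift _ _]/(unsplit (inr _)) unsplitK.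
by rewrite enum_rankK_in.
Qed.

(** The relation is polynomial in the coordinates of [A] and [q], so it passes to the closure of the
    graph. Over the open cell it follows from [wick_sqr], both sides acquiring the same factor
    [\det G * s ^+ 2]. *)
Lemma wick_vector_pluckerbar A q lam mu : wick_vector A q ->
  lam \in evens n -> mu \in evens n ->
  pluckerbar A lam * q mu ^+ 2 = pluckerbar A mu * q lam ^+ 2.
Proof.
move=> [_ _ closure] el em.
pose N := (n * (n + n) + #|evens n|)%N.
pose VA : 'M[{mpoly L[N]}]_(n, n + n) := \matrix_(i, j) 'X_(lshift _ (mxvec_index i j)).
pose Vq nu (en : nu \in evens n) : {mpoly L[N]} := 'X_(rshift _ (enum_rank_in en nu)).
pose P := \det (colsub (bar lam) VA) * Vq mu em ^+ 2 -
          \det (colsub (bar mu) VA) * Vq lam el ^+ 2.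
have PE A' q' : P.@[graph_coord A' q'] =
    pluckerbar A' lam * q' mu ^+ 2 - pluckerbar A' mu * q' lam ^+ 2.
  have dE nu : (\det (colsub (bar nu) VA)).@[graph_coord A' q'] = pluckerbar A' nu.
    rewrite -det_map_mx; congr (\det _); apply/matrixP => i j; rewrite !mxE.
    by rewrite /= mevalXU graph_coordl.
  by rewrite /P !expr2 mevalB !mevalM !dE !mevalXU !graph_coordr.
apply/eqP; rewrite -subr_eq0 -PE; apply/eqP/closure => G X s Gu sk s0.
by rewrite PE !pluckerbar_mull -!wick_sqr //; ring.
Qed.

End Plucker.

(** * Lagrangian subspaces and transversal coordinate subspaces *)

Section Lagrangian.
Variables (L : fieldType) (n : nat).
Implicit Types (A : 'M[L]_(n, n + n)) (lam : {set 'I_n}).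

Lemma mul_quadQ m p (X : 'M[L]_(m, n + n)) (Y : 'M[L]_(p, n + n)) i j :
  (X *m quadQ L n *m Y^T) i j =
  \sum_l (X i (lshift n l) * Y j (rshift n l) + X i (rshift n l) * Y j (lshift n l)).
Proof.
rewrite -[X in LHS]hsubmxK -[Y in LHS]hsubmxK /quadQ mul_row_block tr_row_mx.
rewrite !mulmx0 !mulmx1 add0r addr0 mul_row_col addrC big_split /= !mxE.
by congr (_ + _); apply: eq_bigr => l _; rewrite !mxE.
Qed.

Lemma totally_isotropicE A :
  totally_isotropic A <-> \rank A = n /\ A *m quadQ L n *m A^T = 0.
Proof.
split=> -[rA H]; split=> //.
  apply/matrixP => i j; have := H (row i A) (row j A) (row_sub _ _) (row_sub _ _).
  move/matrixP/(_ 0 0); rewrite !mul_quadQ !mxE => ij0; rewrite -[RHS]ij0.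
  by apply: eq_bigr => l _; rewrite !mxE.
move=> x y /submxP[a ->] /submxP[b ->].
by rewrite trmx_mul mulmxA -(mulmxA a) -(mulmxA a) H mulmx0 mul0mx.
Qed.

Lemma ker_colsub_barP A lam (a : 'rV[L]_n) :
  reflect (forall j, (a *m A) 0 (bar lam j) = 0)
          (a <= kermx (colsub (bar lam) A))%MS.
Proof.
apply: (iffP sub_kermxP); rewrite mulmx_colsub.
  by move=> /rowP H j; have := H j; rewrite !mxE.
by move=> H; apply/rowP => j; have := H j; rewrite !mxE.
Qed.

(* If no bar lam is transversal, take lam meeting F in the least dimension and
   flip it at an index where a vector of the intersection is nonzero. *)
Lemma lagrangian_pluckerbar A : totally_isotropic A ->
  exists lam, pluckerbar A lam != 0.
Proof.
move=> /totally_isotropicE [rA iA]; pose K lam := kermx (colsub (bar lam) A).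
have [lam _ lam_min] := @arg_minnP {set 'I_n} finset.set0 xpredT
  (fun l => \rank (K l)) isT.
exists lam; apply: contraT; rewrite negbK => /eqP d0.
have /rowV0Pn [a aK a0] : K lam != 0.
  by rewrite kermx_eq0 row_free_unit unitmxE -/(pluckerbar A lam) d0 unitr0.
have fA : row_free A by rewrite /row_free rA.
have xlam := elimT (ker_colsub_barP _ _ _) aK.
set x := a *m A in xlam.
have x0 : x != 0.
  by apply: contra a0 => /eqP x0; apply/eqP/(row_free_inj fA); rewrite mul0mx.
(* [x] vanishes at all [bar lam], so its nonzero entries sit in the complementary positions. *)
have [i xi] : exists i, x 0 (bar (~: lam) i) != 0.
  have /rV0Pn [j xj] := x0.
  by case: (split_ordP j) xj => i -> xi; exists i; move: (xlam i) xi;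
    rewrite /bar finset.in_setC; case: (i \in lam) => //= ->; rewrite eqxx.
pose mu : {set 'I_n} := finset (fun j => (j == i) (+) (j \in lam)).
have muE j : bar mu j = if j == i then bar (~: lam) j else bar lam j.
  by rewrite /bar finset.in_set finset.in_setC; case: (j == i); case: (j \in lam).
have /negP[] : ~~ (\rank (K lam) <= \rank (K mu))%N; last exact: lam_min.
rewrite -ltnNge; apply: (proj2 (andP (etrans (esym (ltmxErank _ _)) _))).
rewrite ltmxE; apply/andP; split; last first.
  apply: contra xi => /(submx_trans aK)/ker_colsub_barP/(_ i).
  by rewrite muE eqxx => ->.
apply/rV_subP => b /ker_colsub_barP bmu; apply/ker_colsub_barP => j.
have [->|ji] := eqVneq j i; last by have := bmu j; rewrite muE (negPf ji).
(* In this pairing only the term at [i] survives, as [b *m A] vanishes at [bar lam j] for the other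
   [j]. Since [x] is nonzero at [bar (~: lam) i], [b *m A] vanishes at [bar lam i] too. *)
have : (x *m quadQ L n *m (b *m A)^T) 0 0 = 0.
  by rewrite trmx_mul mulmxA -(mulmxA a) -(mulmxA a) iA mulmx0 mul0mx mxE.
have pairE l : x 0 (lshift n l) * (b *m A) 0 (rshift n l) +
    x 0 (rshift n l) * (b *m A) 0 (lshift n l) =
    x 0 (bar (~: lam) l) * (b *m A) 0 (bar lam l).
  have := xlam l; rewrite /bar finset.in_setC.
  by case: (l \in lam) => /= ->; rewrite mul0r ?add0r ?addr0.
rewrite mul_quadQ (eq_bigr _ (fun l _ => pairE l)) (bigD1 i) //= big1 ?addr0.
  by move/eqP; rewrite mulf_eq0 (negPf xi) => /eqP.
by move=> l li; have := bmu l; rewrite muE (negPf li) => ->; rewrite mulr0.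
Qed.

End Lagrangian.

(** * Valuation ring and residue map *)

Section ValuationRing.
Variables (R : realType) (k : fieldType).
Local Notation K := (hahn R k).
Implicit Types (f g : K) (a b c : R).

(** Lower bounds [a], [b] on the supports replace valuations, so that zero series are covered as
    well. *)
Lemma conv_low a b f g :
  (forall c, c < a -> f c = 0) -> (forall c, c < b -> g c = 0) ->
  (forall c, c < a + b -> (f * g) c = 0) /\ (f * g) (a + b) = f a * g b.
Proof.
move=> fa gb; have fN c : f c != 0 -> a <= c.
  by move=> fc; rewrite leNgt; apply: contra fc => /fa ->.
have gN c : g c != 0 -> b <= c.
  by move=> gc; rewrite leNgt; apply: contra gc => /gb ->.
split=> [c|].
  move=> cab; apply/eqP; apply: contraTT cab => /conv_neq0[d /fN ad /gN bd].
  by rewrite -leNgt; have := lerD ad bd; rewrite addrCA subrr addr0.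
rewrite [LHS](@convE _ _ f g (a + b) [:: a]) //.
  by rewrite big_seq1 addrC addKr.
move=> c /fN ac /gN bc; rewrite inE eq_le ac andbT.
by move: bc; rewrite lerBrDr addrC lerD2r.
Qed.

Lemma tpowE a f c : (tpow k a * f) c = f (c - a).
Proof. by rewrite coef_monoM mul1r. Qed.

Lemma tpowD a b : tpow k (a + b) = tpow k a * tpow k b.
Proof.
by apply: hahnP => c; rewrite tpowE !hahn_monoE subr_eq addrC.
Qed.

Lemma tpowK a : tpow k a * tpow k (- a) = 1.
Proof. by rewrite -tpowD subrr. Qed.

Lemma tpow_neq0 a : tpow k a != 0.
Proof. by apply: contra_eq_neq (tpowK a) => ->; rewrite mul0r eq_sym oner_eq0. Qed.

Lemma hval_unique c f : f c != 0 -> (forall a, a < c -> f a = 0) -> hval f = c.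
Proof.
move=> fc flow; have f0 : f != 0 by apply: contra fc => /eqP ->; rewrite hcoef0.
have [fv vmin] := hvalP f0.
apply/eqP; rewrite eq_le vmin //= leNgt.
by apply: contra fv => /flow ->.
Qed.

Lemma hval_low f a : a < hval f -> f a = 0.
Proof.
have [->|f0] := eqVneq f 0; first by rewrite hcoef0.
have [_ vmin] := hvalP f0; move=> av; apply/eqP; apply: contraTT av => /vmin.
by rewrite -leNgt.
Qed.

Lemma hvalM f g : f != 0 -> g != 0 -> hval (f * g) = hval f + hval g.
Proof.
move=> f0 g0; have [low e] := conv_low (@hval_low f) (@hval_low g).
apply: hval_unique low; rewrite e mulf_neq0 //.
  by have [] := hvalP f0.
by have [] := hvalP g0.
Qed.

Lemma hval_tpow a : hval (tpow k a) = a.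
Proof.
apply: hval_unique => [|b /lt_eqF]; rewrite hahn_monoE ?eqxx ?oner_eq0 //.
by move=> ->.
Qed.

Lemma residue_is_zmod_morphism : zmod_morphism (@residue R k).
Proof. by move=> f g; rewrite /residue hcoefB. Qed.
HB.instance Definition _ :=
  GRing.isZmodMorphism.Build K k (@residue R k) residue_is_zmod_morphism.

Lemma residue_sum I (r : seq I) (P : pred I) (F : I -> K) :
  residue (\sum_(i <- r | P i) F i) = \sum_(i <- r | P i) residue (F i).
Proof. exact: raddf_sum. Qed.

Lemma residueD f g : residue (f + g) = residue f + residue g.
Proof. exact: raddfD. Qed.

Lemma residueB f g : residue (f - g) = residue f - residue g.
Proof. exact: raddfB. Qed.

Lemma residueN f : residue (- f) = - residue f.
Proof. exact: raddfN. Qed.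

(** Stated through coefficients because [hval] has a junk value at 0. *)
Definition valring : {pred K} := fun f => `[< forall a, a < 0 -> f a = 0 >].

Lemma valringP f : reflect (forall a, a < 0 -> f a = 0) (f \in valring).
Proof. exact: asboolP. Qed.

Lemma residueM : {in valring &, {morph @residue R k : f g / f * g}}.
Proof.
move=> f g /valringP f0 /valringP g0.
by have [_] := conv_low f0 g0; rewrite addr0.
Qed.

Lemma residue1 : residue (1 : K) = 1.
Proof. by rewrite /residue hcoef1 eqxx. Qed.

Fact valring_subring : subring_closed valring.
Proof.
split=> [|f g /valringP f0 /valringP g0|f g /valringP f0 /valringP g0].
- by apply/valringP => a /lt_eqF; rewrite hcoef1 => ->.
- by apply/valringP => a a0; rewrite hcoefB f0 // g0 // subr0.
- by apply/valringP => a a0; have [low _] := conv_low f0 g0; rewrite low // addr0.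
Qed.
HB.instance Definition _ := GRing.isSubringClosed.Build K valring valring_subring.

Lemma residue_prod I (r : seq I) (P : pred I) (F : I -> K) :
  (forall i, F i \in valring) ->
  residue (\prod_(i <- r | P i) F i) = \prod_(i <- r | P i) residue (F i).
Proof.
move=> FV; elim: r => [|i r IH]; first by rewrite !big_nil residue1.
rewrite !big_cons; case: ifP => // _; rewrite residueM ?IH //.
exact: rpred_prod.
Qed.

Lemma residueX f m : f \in valring -> residue (f ^+ m) = residue f ^+ m.
Proof.
move=> fV; elim: m => [|m IH]; first exact: residue1.
by rewrite !exprS residueM ?rpredX // IH.
Qed.

Lemma det_valring m (A : 'M[K]_m) : (forall i j, A i j \in valring) ->
  \det A \in valring.
Proof.
move=> AV; apply: rpred_sum => s _; rewrite rpredMsign.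
exact: rpred_prod.
Qed.

Lemma residue_det m (A : 'M[K]_m) : (forall i j, A i j \in valring) ->
  residue (\det A) = \det (map_mx (@residue R k) A).
Proof.
move=> AV; rewrite residue_sum; apply: eq_bigr => s _.
rewrite residueM ?rpred_sign ?rpred_prod //.
rewrite residueX ?rpredN ?rpred1 // residueN residue1 residue_prod //.
by congr (_ * _); apply: eq_bigr => i _; rewrite mxE.
Qed.

Lemma residue_mulmx m n p (A : 'M[K]_(m, n)) (B : 'M[K]_(n, p)) :
  (forall i j, A i j \in valring) -> (forall i j, B i j \in valring) ->
  map_mx (@residue R k) (A *m B) = map_mx (@residue R k) A *m map_mx (@residue R k) B.
Proof.
move=> AV BV; apply/matrixP => i j; rewrite !mxE residue_sum.
by apply: eq_bigr => l _; rewrite !mxE; apply: residueM.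
Qed.

Lemma hahnC_valring x : hahnC R x \in valring.
Proof. by apply/valringP => a /lt_eqF; rewrite hahn_monoE => ->. Qed.

Lemma hahnCK : cancel (@hahnC R k) (@residue R k).
Proof. by move=> x; rewrite /residue hahn_monoE eqxx. Qed.

Lemma valring_hval f : f != 0 -> (f \in valring) = (0 <= hval f).
Proof.
move=> f0; apply/idP/idP => [/valringP fV|v0].
  by rewrite leNgt; have [fv _] := hvalP f0; apply: contra fv => /fV ->.
by apply/valringP => a a0; apply: hval_low; apply: lt_le_trans v0.
Qed.

Lemma residue_neq0 f : f != 0 -> f \in valring -> (residue f != 0) = (hval f == 0).
Proof.
move=> f0; rewrite (valring_hval f0) /residue le_eqVlt => /orP[/eqP v0|v0].
  by rewrite -v0 eqxx; have [+ _] := hvalP f0; rewrite -v0.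
by rewrite (hval_low v0) eqxx gt_eqF.
Qed.

End ValuationRing.

(** * Integral echelon bases *)

Lemma det_replace_col1 (L : comNzRingType) n (B : 'M[L]_n) i :
  (forall a b, b != i -> B a b = (a == b)%:R) -> \det B = B i i.
Proof.
case: n B i => [|n] B i; first by case: i.
move=> Bid; rewrite (expand_det_row _ i) (bigD1 i) //= big1 ?addr0; last first.
  by move=> j ji; rewrite Bid // eq_sym (negPf ji) mul0r.
rewrite /cofactor addnn -signr_odd odd_double mul1r.
have -> : row' i (col' i B) = 1%:M.
  by apply/matrixP => a b; rewrite !mxE Bid ?(inj_eq lift_inj) // eq_sym neq_lift.
by rewrite det1 mulr1.
Qed.

Section Lattice.
Variables (R : realType) (k : fieldType).
Local Notation K := (hahn R k).

(* By Cramer's rule the entries of the reduced matrix are quotients of maximal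
   minors, hence integral when the denominator has the least valuation. *)
Lemma integral_echelon n m (A : 'M[K]_(n, m)) : \rank A = n ->
  exists2 s : 'I_n -> 'I_m, colsub s A \in unitmx &
    forall i j, (invmx (colsub s A) *m A) i j \in @valring R k.
Proof.
move=> rA; pose d (s : {ffun 'I_n -> 'I_m}) := \det (colsub s A).
have fA : row_full A^T by rewrite /row_full mxrank_tr rA.
have d0 : d (fullrankfun fA) != 0.
  have := fullrowsub_unit fA; rewrite unitmxE unitfE -det_tr.
  congr (is_true (_ != 0)); congr (\det _).
  by apply/matrixP => i j; rewrite !mxE.
have [s ds smin] := @Order.TotalTheory.arg_minP _ _ _
  (fullrankfun fA) (fun s => d s != 0) (fun s => hval (d s)) d0.
have us : colsub s A \in unitmx by rewrite unitmxE unitfE.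
exists s => // i j; set A' := invmx _ *m A.
have sA' : colsub s A' = 1%:M by rewrite -mulmx_colsub mulVmx.
(* Exchanging the [i]-th chosen column for [j] multiplies the minor by the entry [A' i j]. *)
pose s' : {ffun 'I_n -> 'I_m} := [ffun l => if l == i then j else s l].
have ds' : d s' = d s * A' i j.
  have -> : A' i j = \det (colsub s' A').
    rewrite (@det_replace_col1 _ _ _ i) => [|a b bi].
      by rewrite [RHS]mxE ffunE eqxx.
    by have /matrixP/(_ a b) := sA'; rewrite [LHS]mxE [RHS]mxE [in X in _ -> X]mxE ffunE (negPf bi).
  by rewrite /d -det_mulmx mulmx_colsub mulmxA mulmxV // mul1mx.
have [->|A0] := eqVneq (A' i j) 0; first exact: rpred0.
rewrite valring_hval // -(lerD2l (hval (d s))) addr0 -hvalM // -ds'.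
by apply: smin; rewrite ds' mulf_neq0.
Qed.

End Lattice.

(** * Ideals and congruences *)

Section IdealSpan.
Variables (A : comNzRingType) (G : classical_sets.set A).
Local Notation J := (ideal_span (@classical_sets.setT A) G).

Lemma ideal_span0 : J 0.
Proof. by exists [::]; split=> //; rewrite big_nil. Qed.

Lemma ideal_span_gen g : G g -> J g.
Proof.
move=> Gg; exists [:: (1, g)]; split; last by rewrite big_seq1 mul1r.
by move=> p; rewrite inE => /eqP ->.
Qed.

Lemma ideal_spanD a b : J a -> J b -> J (a + b).
Proof.
move=> [r [rG ->]] [s [sG ->]]; exists (r ++ s); split; last by rewrite big_cat.
by move=> p; rewrite mem_cat => /orP[/rG|/sG].
Qed.

Lemma ideal_spanM c a : J a -> J (c * a).
Proof.
move=> [r [rG ->]]; exists [seq (c * p.1, p.2) | p <- r]; split.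
  by move=> _ /mapP[p /rG [_ Gp] ->].
by rewrite big_map big_distrr; apply: eq_bigr => p _; rewrite /= mulrA.
Qed.

Lemma ideal_span_min (I : classical_sets.set A) : I 0 ->
  (forall a b, I a -> I b -> I (a + b)) -> (forall c a, I a -> I (c * a)) ->
  (forall g, G g -> I g) -> forall a, J a -> I a.
Proof.
move=> I0 ID IM GI a [r [rG ->]].
by rewrite big_seq; apply: big_ind => // p /rG [_ /GI]; apply: IM.
Qed.

Definition cong_mod a b := J (a - b).

Lemma cong_modD a b c d : cong_mod a b -> cong_mod c d -> cong_mod (a + c) (b + d).
Proof. by move=> /ideal_spanD H /H; rewrite addrACA -opprD. Qed.

Lemma cong_modM a b c d : cong_mod a b -> cong_mod c d -> cong_mod (a * c) (b * d).
Proof.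
move=> /(ideal_spanM c) /ideal_spanD H /(ideal_spanM b) /H.
by rewrite /cong_mod; congr (ideal_span _ _ _); ring.
Qed.

Lemma cong_mod_refl a : cong_mod a a.
Proof. by rewrite /cong_mod subrr; apply: ideal_span0. Qed.

Lemma cong_modX m a b : cong_mod a b -> cong_mod (a ^+ m) (b ^+ m).
Proof.
move=> ab; elim: m => [|m IH]; first exact: cong_mod_refl.
by rewrite !exprS; apply: cong_modM.
Qed.

End IdealSpan.

(** * Polynomials vanishing at every point *)

Section Nullity.
Variables (k : fieldType).
Hypothesis k0 : [pchar k] =i pred0.

Lemma natr_inj_pchar0 : injective (fun m => m%:R : k).
Proof.
have le_inj i j : (i <= j)%N -> i%:R = j%:R :> k -> i = j.
  move=> ij /eqP; rewrite eq_sym -subr_eq0 -natrB //.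
  move/pcharf0P: k0 => -> ; lia.
by move=> i j; case/orP: (leq_total i j) => /le_inj H // /esym /H.
Qed.

(** In characteristic 0 the natural numbers supply more roots than the degree allows. *)
Lemma poly_horner_eq0 (p : {poly k}) : (forall t, p.[t] = 0) -> p = 0.
Proof.
move=> p0; apply/eqP; apply: contraT => pN0.
have := @max_poly_roots _ p [seq m%:R | m <- iota 0 (size p)] pN0.
rewrite size_map size_iota ltnn; apply.
  by apply/allP => t _; rewrite rootE p0.
by rewrite (map_inj_uniq natr_inj_pchar0) iota_uniq.
Qed.

(** Uniqueness of base [d] digits, which keeps monomials apart under Kronecker's substitution. *)
Lemma radix_inj d n (a b : 'I_n -> nat) :
  (forall i, a i < d)%N -> (forall i, b i < d)%N ->
  (\sum_i a i * d ^ i = \sum_i b i * d ^ i)%N -> a =1 b.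
Proof.
elim: n a b => [|n IH] a b ad bd; first by move=> _ [].
have shift (c : 'I_n.+1 -> nat) :
    (\sum_i c i * d ^ i = c ord0 + d * \sum_(i < n) c (lift ord0 i) * d ^ i)%N.
  rewrite big_ord_recl muln1 big_distrr; congr (_ + _)%N.
  by apply: eq_bigr => i _; rewrite lift0 expnS mulnCA.
rewrite !shift => e.
have d0 : (0 < d)%N by apply: leq_ltn_trans (ad ord0).
have e0 : a ord0 = b ord0.
  by have := congr1 (modn^~ d) e; rewrite /= !(mulnC d) !(addnC _ (_ * d)%N) !modnMDl !modn_small.
have /IH H : (\sum_(i < n) a (lift ord0 i) * d ^ i =
              \sum_(i < n) b (lift ord0 i) * d ^ i)%N.
  by move: e; rewrite e0 => /addnI /eqP; rewrite eqn_pmul2l // => /eqP.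
by move=> i; case: (unliftP ord0 i) => [j|] -> //; apply: H.
Qed.

(* Kronecker's substitution X_i := T ^ (d ^ i) is injective on polynomials of
   degree less than d. *)
Lemma meval_eq0 N (f : {mpoly k[N]}) : (forall v, f.@[v] = 0) -> f = 0.
Proof.
move=> f0; pose d := (msize f).+1; pose e (m : 'X_{1..N}) := (\sum_i m i * d ^ i)%N.
have small m i : m \in msupp f -> (m i < d)%N.
  move=> /msize_mdeg_lt; rewrite ltnS; apply: leq_trans; apply: leqW.
  by rewrite mdegE (bigD1 i) //= leq_addr.
have e_inj m m' : m \in msupp f -> m' \in msupp f -> e m = e m' -> m = m'.
  by move=> mf m'f /radix_inj H; apply/mnmP => i; apply: H => j; apply: small.
pose p : {poly k} := \sum_(m <- msupp f) f@_m *: 'X^(e m).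
have p0 : p = 0.
  apply: poly_horner_eq0 => t; rewrite -[RHS](f0 (fun i => t ^+ (d ^ i))) mevalE.
  rewrite horner_sum; apply: eq_bigr => m _; rewrite hornerZ hornerXn.
  by rewrite -prodrXr; congr (_ * _); apply: eq_bigr => i _; rewrite -exprM mulnC.
apply/mpolyP => m; rewrite mcoeff0; apply/eqP; rewrite mcoeff_eq0; apply/negP => mf.
have := congr1 (fun p : {poly k} => p`_(e m)) p0; rewrite coef0 coef_sum.
rewrite (bigD1_seq m) ?msupp_uniq //= big_seq_cond big1 ?addr0.
  by rewrite coefZ coefXn eqxx mulr1 => /eqP; rewrite mcoeff_eq0 mf.
move=> m' /andP[m'f ne]; rewrite coefZ coefXn; case: eqP => [/e_inj|]; rewrite ?mulr0 //.
by move=> /(_ mf m'f) E; rewrite E eqxx in ne.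
Qed.

End Nullity.

(** * The ideal of a linear subspace in echelon form *)

Section LinIdeal.
Variables (k : fieldType) (n : nat) (E : 'M[k]_(n, n + n)).

Lemma lin_ideal0 : lin_ideal E 0.
Proof. by move=> x _; rewrite meval0. Qed.

Lemma lin_idealD f g : lin_ideal E f -> lin_ideal E g -> lin_ideal E (f + g).
Proof. by move=> If Ig x xE; rewrite mevalD If // Ig // addr0. Qed.

Lemma lin_idealM c f : lin_ideal E f -> lin_ideal E (c * f).
Proof. by move=> If x xE; rewrite mevalM If // mulr0. Qed.

Hypothesis k0 : [pchar k] =i pred0.
Variable s : 'I_n -> 'I_(n + n).
Hypothesis sE : colsub s E = 1%:M.

(** The comorphism of the linear projection onto the row space of [E] that preserves the coordinates
    [s]. *)
Definition retraction : (n + n).-tuple {mpoly k[n + n]} :=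
  [tuple \sum_i E i j *: 'X_(s i) | j < n + n].

Lemma meval_retraction (f : {mpoly k[n + n]}) v :
  (f \mPo retraction).@[v] = f.@[fun j => ((\row_i v (s i)) *m E) 0 j].
Proof.
rewrite comp_mpoly_meval; apply: meval_eq => j.
rewrite tnth_mktuple raddf_sum mxE; apply: eq_bigr => i _.
by rewrite /= mevalZ mevalXU mxE mulrC.
Qed.

(** The projection maps into the row space and fixes it, so vanishing there means that the composite
    vanishes at all points, hence is 0. *)
Lemma lin_ideal_echelon f : lin_ideal E f <-> f \mPo retraction = 0.
Proof.
split=> [If|f0 _ /submxP[y ->]].
  by apply: (meval_eq0 k0) => v; rewrite meval_retraction If // submxMl.
have := meval_retraction f (fun j => (y *m E) 0 j); rewrite f0 meval0.
have -> : \row_i (y *m E) 0 (s i) = y.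
  rewrite -[RHS]mulmx1 -sE mulmx_colsub; apply/rowP => i.
  by rewrite [LHS]mxE [RHS]mxE.
by move=> <-.
Qed.

(** The ideal is the kernel of a ring morphism to a domain. *)
Lemma lin_ideal_prime f g : lin_ideal E (f * g) -> lin_ideal E f \/ lin_ideal E g.
Proof.
move/lin_ideal_echelon; rewrite rmorphM => /eqP; rewrite mulf_eq0.
by case/orP => /eqP ?; [left|right]; apply/lin_ideal_echelon.
Qed.

(** Modulo these forms each variable is congruent to its image under [retraction], hence [f] to
    [f \mPo retraction], which is 0. *)
Lemma lin_ideal_span f : lin_ideal E f ->
  ideal_span (@classical_sets.setT _)
    (fun z => exists j, z = 'X_j - \sum_i E i j *: 'X_(s i)) f.
Proof.
move=> /lin_ideal_echelon f0; rewrite -[f]subr0 -[X in _ _ (f - X)]f0 comp_mpolyEX [X in X - _]mpolyE.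
apply: (big_rec2 (fun a b => cong_mod _ a b)); first exact: cong_mod_refl.
move=> m a b _; apply: cong_modD; rewrite -!mul_mpolyC.
apply: cong_modM; first exact: cong_mod_refl.
rewrite comp_mpolyX mpolyXE_id.
apply: (big_rec2 (fun a b => cong_mod _ a b)); first exact: cong_mod_refl.
move=> j c d _; apply: cong_modM; apply: cong_modX.
by apply: ideal_span_gen; exists j; rewrite tnth_mktuple.
Qed.

End LinIdeal.

#[local] Arguments residue {R k} f : simpl never.

(** * Initial forms and the initial ideal of a linear space *)

Lemma seq_minP (R : realDomainType) (T : eqType) (F : T -> R) (s : seq T) :
  s != [::] -> exists2 m, m \in s & all (fun m' => F m <= F m') s.
Proof.
elim: s => [//|x s IH] _; have [->|/IH [m ms mmin]] := eqVneq s [::].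
  by exists x; rewrite ?mem_head //= lexx.
case: (leP (F x) (F m)) => xm.
  exists x; rewrite ?mem_head //= lexx.
  by apply/allP => y /(allP mmin); apply: le_trans.
by exists m; rewrite ?inE ?ms ?orbT //= (ltW xm).
Qed.

Section InitialLinear.
Variables (R : realType) (k : fieldType).
Local Notation K := (hahn R k).

Lemma colsub_residue m n (A : 'M[K]_(m, n)) (s : 'I_m -> 'I_n) :
  colsub s A = 1%:M -> colsub s (map_mx (@residue R k) A) = 1%:M.
Proof.
move=> sA; apply/matrixP => i j; have /matrixP/(_ i j) := sA; rewrite !mxE => ->.
by case: eqP => _; rewrite ?residue1 ?raddf0.
Qed.

Section Weights.
Variables (N : nat) (v : 'I_N -> R).

Lemma weightU j : weight v U_(j) = v j.
Proof.
rewrite /weight (bigD1 j) //= big1 => [|i ij].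
  by rewrite mnmE eqxx mulr1n addr0.
by rewrite mnmE eq_sym (negPf ij).
Qed.

Lemma tpow_weight m : tpow k (weight v m) = \prod_i tpow k (v i) ^+ m i.
Proof.
rewrite /weight; apply: (big_rec2 (fun a b => tpow k a = b)) => // i a b _ <-.
rewrite tpowD; congr (_ * _); elim: (m i) => // p IH.
by rewrite mulrS tpowD IH exprS.
Qed.

Variables (f : {mpoly K[N]}) (c : R).
(** The coefficients of [f] after substituting [t^v y] for [y] and multiplying by [t^(-c)]. *)
Let r m := tpow k (weight v m - c) * f@_m.
Hypothesis rV : forall m, r m \in @valring R k.

(** Given integrality, one nonzero residue forces [c] to be the least weight; the nonzero residues
    then sit exactly at the monomials attaining it. *)
Lemma vinit_sum : (exists m, residue (r m) != 0) ->
  vinit v f = \sum_(m <- msupp f) residue (r m) *: 'X_[m].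
Proof.
move=> [m0 m0P]; rewrite /vinit big_mkcond /=; apply: eq_big_seq => m mf.
have fN m' : m' \in msupp f -> f@_m' != 0 by rewrite mcoeff_msupp.
have hr m' : m' \in msupp f -> hval (r m') = vweight v f m' - c.
  by move=> /fN f0; rewrite /r hvalM ?tpow_neq0 // hval_tpow addrC addrA.
have rN m' : m' \in msupp f -> r m' != 0.
  by move=> /fN f0; rewrite mulf_neq0 ?tpow_neq0.
have m0f : m0 \in msupp f.
  rewrite mcoeff_msupp; apply: contra m0P => /eqP e.
  by rewrite /r e mulr0 raddf0.
have w0 : vweight v f m0 = c.
  by move: m0P; rewrite residue_neq0 ?rN // hr // subr_eq0 => /eqP.
have cmin m' : m' \in msupp f -> c <= vweight v f m'.
  by move=> m'f; have := rV m'; rewrite valring_hval ?rN // hr // subr_ge0.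
case: ifPn => [/allP/(_ _ m0f)|nmin].
  rewrite w0 => wc; have {}wc : vweight v f m = c by apply/eqP; rewrite eq_le wc cmin.
  have e : weight v m - c = - hval f@_m by rewrite -wc opprD addrCA subrr addr0.
  by rewrite /hlead /r e.
suff : ~~ (residue (r m) != 0) by rewrite negbK => /eqP ->; rewrite scale0r.
apply: contra nmin; rewrite residue_neq0 ?rN // hr // subr_eq0 => /eqP ->.
by apply/allP.
Qed.

Lemma mcoeff_vinit m : (exists m, residue (r m) != 0) ->
  (vinit v f)@_m = residue (r m).
Proof.
move=> /vinit_sum ->; rewrite raddf_sum /=.
have [mf|mf] := boolP (m \in msupp f).
  rewrite (bigD1_seq m) ?msupp_uniq //= mcoeffZ mcoeffX eqxx mulr1 big1 ?addr0 //.
  by move=> m' ne; rewrite mcoeffZ mcoeffX (negPf ne) mulr0.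
rewrite {2}/r (memN_msupp_eq0 mf) mulr0 raddf0 big_seq big1 // => m' m'f.
rewrite mcoeffZ mcoeffX; case: eqP => [e|_]; rewrite ?mulr0 //.
by rewrite -e m'f in mf.
Qed.

End Weights.

Lemma vinit_weight N (v : 'I_N -> R) (f : {mpoly K[N]}) : f != 0 ->
  exists c, (forall m, tpow k (weight v m - c) * f@_m \in @valring R k) /\
    exists m, residue (tpow k (weight v m - c) * f@_m) != 0.
Proof.
move=> f0; have [|m0 m0f /allP m0min] := @seq_minP R _ (vweight v f) (msupp f).
  by rewrite msupp_eq0.
have hr m : m \in msupp f ->
    hval (tpow k (weight v m - vweight v f m0) * f@_m) = vweight v f m - vweight v f m0.
  rewrite mcoeff_msupp => fm.
  by rewrite hvalM ?tpow_neq0 // hval_tpow addrC addrA.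
have rN m : m \in msupp f -> tpow k (weight v m - vweight v f m0) * f@_m != 0.
  by rewrite mcoeff_msupp => fm; rewrite mulf_neq0 ?tpow_neq0.
have rV m : tpow k (weight v m - vweight v f m0) * f@_m \in @valring R k.
  have [mf|mf] := boolP (m \in msupp f); last by rewrite (memN_msupp_eq0 mf) mulr0 rpred0.
  by rewrite valring_hval ?rN // hr // subr_ge0 m0min.
exists (vweight v f m0); split=> //; exists m0.
by rewrite residue_neq0 ?rN // hr // subrr.
Qed.

Variables (n : nat) (F : 'M[K]_(n, n + n)) (v : 'I_(n + n) -> R) (G : 'M[K]_n).
(** Substituting [t^v y] in polynomials corresponds to scaling points by [t^(-v)]; [G] only changes
    the basis. *)
Let A := G *m (F *m diag_mx (\row_j tpow k (- v j))).
Hypotheses (Gu : G \in unitmx) (AV : forall i j, A i j \in @valring R k).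
Let F0 := map_mx (@residue R k) A.

Lemma rescaled_row (b : 'rV[K]_n) j : (b *m A) 0 j = tpow k (- v j) * (b *m G *m F) 0 j.
Proof. by rewrite /A !mulmxA mul_mx_diag !mxE mulrC. Qed.

(** A point of [F0] lifts to an integral combination of the rows of [A]. Evaluating [f] at the
    corresponding point of [F], multiplying by [t^(-c)] and reducing gives the value of the initial
    form. *)
Lemma lin_ideal_vinit f : lin_ideal F f -> lin_ideal F0 (vinit v f).
Proof.
move=> If; have [->|f0] := eqVneq f 0.
  by rewrite /vinit msupp0 big_nil; apply: lin_ideal0.
have [c [rV rN]] := vinit_weight v f0.
move=> _ /submxP[a ->]; rewrite (vinit_sum rV rN) raddf_sum.
pose b := map_mx (@hahnC R k) a.
have bV i j : b i j \in @valring R k by rewrite mxE hahnC_valring.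
have yV j : (b *m A) 0 j \in @valring R k.
  by rewrite mxE rpred_sum // => i _; rewrite rpredM.
have yE : a *m F0 = map_mx (@residue R k) (b *m A).
  rewrite residue_mulmx //; congr (_ *m _).
  by apply/matrixP => i j; rewrite !mxE hahnCK.
have := If (b *m G *m F) (submxMl _ _); rewrite mevalE.
move=> /(congr1 (fun z => residue (tpow k (- c) * z))).
rewrite mulr0 raddf0 => f0'; rewrite -[RHS]f0' big_distrr residue_sum.
apply: eq_bigr => m _ /=; rewrite mevalZ mevalX.
have -> : \prod_i (b *m G *m F) 0 i ^+ m i =
    tpow k (weight v m) * \prod_i (b *m A) 0 i ^+ m i.
  rewrite tpow_weight -big_split; apply: eq_bigr => i _ /=.
  by rewrite rescaled_row exprMn mulrA -exprMn tpowK expr1n mul1r.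
have -> : tpow k (- c) * (f@_m * (tpow k (weight v m) * \prod_i (b *m A) 0 i ^+ m i)) =
   (tpow k (weight v m - c) * f@_m) * \prod_i (b *m A) 0 i ^+ m i.
  by rewrite tpowD; ring.
have yXV i : (b *m A) 0 i ^+ m i \in @valring R k by apply: rpredX.
have yPV : \prod_i (b *m A) 0 i ^+ m i \in @valring R k by apply: rpred_prod.
rewrite [RHS]residueM ?residue_prod //.
by congr (_ * _); apply: eq_bigr => i _; rewrite yE mxE residueX.
Qed.

Variable s : 'I_n -> 'I_(n + n).
Hypothesis sA : colsub s A = 1%:M.

Lemma linear_form_vinit j :
  in_lin_ideal F v ('X_j - \sum_i F0 i j *: 'X_(s i)).
Proof.
(* For a pivot column the form is 0. *)
have [[i0 ->]|js] := pselect (exists i, j = s i).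
  rewrite (bigD1 i0) //= big1 => [|i ii0].
    have /matrixP/(_ i0 i0) := colsub_residue sA; rewrite !mxE eqxx => ->.
    by rewrite scale1r addr0 subrr; apply: ideal_span0.
  have /matrixP/(_ i i0) := colsub_residue sA; rewrite !mxE (negPf ii0) => ->.
  by rewrite scale0r.
(* The lift of the form to the ideal of [F]. Its rescaled coefficients are integral and that of
   ['X_j] is 1, so its least weight is 0. *)
pose f : {mpoly K[n + n]} := tpow k (- v j) *: 'X_j -
  \sum_i (A i j * tpow k (- v (s i))) *: 'X_(s i).
have fE m : tpow k (weight v m - 0) * f@_m =
    (U_(j)%MM == m)%:R - \sum_i A i j * (U_(s i)%MM == m)%:R.
  rewrite subr0 mcoeffB raddf_sum mcoeffZ mcoeffX mulrBr; congr (_ - _).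
    by case: eqP => [<-|_]; rewrite ?mulr0 // mulr1 weightU tpowK.
  rewrite big_distrr; apply: eq_bigr => i _ /=; rewrite mcoeffZ mcoeffX.
  case: eqP => [<-|_]; rewrite ?mulr0 // !mulr1 weightU.
  by rewrite mulrCA tpowK mulr1.
have natV (d : bool) : (d%:R : K) \in @valring R k by case: d; rewrite ?rpred0 ?rpred1.
have resN (d : bool) : residue (d%:R : K) = d%:R by case: d; rewrite ?residue1 ?raddf0.
have fV m : tpow k (weight v m - 0) * f@_m \in @valring R k.
  by rewrite fE rpredB ?rpred_sum // => i _; rewrite rpredM.
have rE m : residue (tpow k (weight v m - 0) * f@_m) =
    ('X_j - \sum_i F0 i j *: 'X_(s i))@_m.
  rewrite fE residueB residue_sum resN mcoeffB (raddf_sum (mcoeff m)) mcoeffX.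
  congr (_ - _); apply: eq_bigr => i _; rewrite /= mcoeffZ mcoeffX.
  by rewrite [LHS]residueM ?resN // [in RHS]mxE.
apply: ideal_span_gen; exists f.
  move=> _ /submxP[b ->]; rewrite mevalB mevalZ mevalXU (raddf_sum (meval _)).
  have e l : tpow k (- v l) * (b *m F) 0 l = (b *m invmx G *m A) 0 l.
    by rewrite rescaled_row -(mulmxA b) mulVmx // mulmx1.
  rewrite e; apply/eqP; rewrite subr_eq0; apply/eqP.
  have := congr1 (mulmx (b *m invmx G)) sA; rewrite mulmx_colsub mulmx1.
  move=> be; rewrite [LHS]mxE; apply: eq_bigr => i _.
  by rewrite /= mevalZ mevalXU -mulrA e -[in LHS]be [in LHS]mxE mulrC.
apply/mpolyP => m; rewrite (@mcoeff_vinit _ v f 0) ?rE //.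
exists U_(j)%MM; rewrite rE mcoeffB (raddf_sum (mcoeff _)) mcoeffX eqxx.
rewrite big1 ?subr0 ?oner_eq0 //.
move=> i _; rewrite /= mcoeffZ mcoeffX; case: eqP => [e|]; rewrite ?mulr0 //.
have /mnmP/(_ (s i)) := e; rewrite !mnmE eqxx; case: eqP => // ji _.
by case: js; exists i.
Qed.

(** Each inclusion is checked on generators: initial forms vanish on [F0], and the linear forms
    cutting out [F0] lift. *)
Lemma in_lin_idealE f : [pchar k] =i pred0 ->
  in_lin_ideal F v f <-> lin_ideal F0 f.
Proof.
move=> k0; split.
  apply: ideal_span_min; [exact: lin_ideal0|exact: lin_idealD|exact: lin_idealM|].
  by move=> _ [g Ig ->]; apply: lin_ideal_vinit.
move=> /(lin_ideal_span k0 (colsub_residue sA)).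
apply: ideal_span_min; [exact: ideal_span0|exact: ideal_spanD|exact: ideal_spanM|].
by move=> _ [j ->]; apply: linear_form_vinit.
Qed.

End InitialLinear.

(** * Laurent extension and saturation by monomials *)

Section TorusClosure.
Variables (k : fieldType) (N : nat) (I : classical_sets.set {mpoly k[N]}).
Local Notation "x %:F" := (@FracField.tofrac _ x).
Hypotheses (I0 : I 0) (ID : forall f g, I f -> I g -> I (f + g))
           (IM : forall c f, I f -> I (c * f)).

Lemma tofracX_neq0 m : ('X_[m] : {mpoly k[N]})%:F != 0.
Proof. by rewrite tofrac_eq0 -msupp_eq0 msuppX. Qed.

(** A finite sum has a common monomial denominator, and [I] absorbs the numerators. *)
Lemma laurent_extP z :
  laurent_ext xpredT I z <-> exists f m, I f /\ z = f%:F / ('X_[m])%:F.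
Proof.
split=> [[r [rI ->]]|[f [m [If ->]]]]; last first.
  exists [:: (1 / ('X_[m])%:F, f%:F)]; split.
    move=> p; rewrite inE => /eqP -> /=; split; last by exists f.
    by exists 1, m; split=> //; rewrite rmorph1.
  by rewrite big_seq1 mul1r mulrC.
elim: r rI => [|p r IH] rI.
  by exists 0, 0%MM; rewrite big_nil rmorph0 mul0r.
have [[a [m [_ _ e1]]] [f If e2]] := rI _ (mem_head _ _).
have [|g [m' [Ig e]]] := IH.
  by move=> p' p'r; apply: rI; rewrite inE p'r orbT.
exists (a * f * 'X_[m'] + g * 'X_[m]), (m + m')%MM; split.
  by apply: ID; rewrite mulrC; apply: IM => //; apply: IM.
rewrite big_cons e e1 e2 mpolyXD tofracD !tofracM mulrAC.
by rewrite addf_div ?tofracX_neq0.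
Qed.

Lemma torus_closureP f : torus_closure I f <-> exists m, I ('X_[m] * f).
Proof.
rewrite /torus_closure laurent_extP; split=> [[g [m [Ig e]]]|[m If]]; last first.
  exists ('X_[m] * f), m; split=> //.
  by rewrite tofracM mulrC mulKf ?tofracX_neq0.
exists m; suff -> : 'X_[m] * f = g by [].
by apply/eqP; rewrite -tofrac_eq tofracM e mulrC divfK ?tofracX_neq0.
Qed.

Lemma laurent_unitP : laurent_unit xpredT I <-> exists m, I 'X_[m].
Proof.
have := torus_closureP 1; rewrite /laurent_unit /torus_closure tofrac1 => ->.
by split=> -[m Im]; exists m; move: Im; rewrite mulr1.
Qed.

End TorusClosure.

(** * Effect of rescaling and reduction on isotropy and Pluecker coordinates *)

Section Reduction.
Variables (R : realType) (k : fieldType) (n : nat).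
Local Notation K := (hahn R k).
Local Notation rescaling u := (diag_mx (\row_j tpow k (- minus_plus u j))).
Implicit Types (F : 'M[K]_(n, n + n)) (u : 'I_n -> R).

Lemma minus_plusl u i : minus_plus u (lshift n i) = - u i.
Proof. by rewrite /minus_plus -[lshift _ _]/(unsplit (inl _)) unsplitK. Qed.

Lemma minus_plusr u i : minus_plus u (rshift n i) = u i.
Proof. by rewrite /minus_plus -[rshift _ _]/(unsplit (inr _)) unsplitK. Qed.

(** The form pairs [y_i] only with its starred partner, and the two are scaled by inverse
    factors. *)
Lemma rescaling_isotropic F u :
  F *m rescaling u *m quadQ K n *m (F *m rescaling u)^T = F *m quadQ K n *m F^T.
Proof.
apply/matrixP => i j; rewrite (mul_quadQ (F *m _)) (mul_quadQ F).
apply: eq_bigr => l _.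
have e (a b x y : K) : x * y = 1 -> a * x * (b * y) = a * b.
  by rewrite mulrACA => ->; rewrite mulr1.
rewrite !mul_mx_diag !mxE minus_plusl minus_plusr opprK.
rewrite (e _ _ _ _ (tpowK k (u l))) (e _ _ _ (tpow k (u l))) //.
by rewrite mulrC tpowK.
Qed.

(** The column [bar lam i] is scaled by [t^(u_i)] for [i] in [lam] and by [t^(-u_i)] otherwise. *)
Lemma rescaling_pluckerbar F u lam :
  pluckerbar (F *m rescaling u) lam =
  tpow k ((\sum_(i in lam) u i) *+ 2 - \sum_i u i) * pluckerbar F lam.
Proof.
have -> : (\sum_(i in lam) u i) *+ 2 - \sum_i u i = \sum_i - minus_plus u (bar lam i).
  rewrite [X in _ - X](bigID (mem lam)) [RHS](bigID (mem lam)) /= mulr2n opprD addrA addrK.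
  congr (_ + _); last rewrite -sumrN.
    by apply: eq_bigr => i il; rewrite /bar il minus_plusl opprK.
  by apply: eq_bigr => i /negPf il; rewrite /bar il minus_plusr.
have tpow_sum (w : 'I_n -> R) : tpow k (\sum_i w i) = \prod_i tpow k (w i).
  by apply: (big_rec2 (fun a b => tpow k a = b)) => // i a b _ <-; rewrite tpowD.
rewrite /pluckerbar mulrC tpow_sum.
rewrite -[X in _ * X](_ : \det (diag_mx (\row_i tpow k (- minus_plus u (bar lam i)))) = _); last first.
  by rewrite det_diag; apply: eq_bigr => i _; rewrite mxE.
rewrite -det_mulmx; congr (\det _); apply/matrixP => i j.
by rewrite !mul_mx_diag !mxE.
Qed.

(** The identity columns survive reduction and keep the rank; the isotropy relations have integral
    terms and reduce. *)
Lemma residue_isotropic (A : 'M[K]_(n, n + n)) (s : 'I_n -> 'I_(n + n)) :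
  (forall i j, A i j \in @valring R k) -> colsub s A = 1%:M ->
  A *m quadQ K n *m A^T = 0 -> totally_isotropic (map_mx (@residue R k) A).
Proof.
move=> AV sA iA; apply/totally_isotropicE; split.
  apply/eqP; rewrite eqn_leq rank_leq_row -{1}[n](mxrank1 k n).
  rewrite -(colsub_residue sA) -[X in colsub s X]mulmx1 -mulmx_colsub.
  exact: mxrankM_maxl.
apply/matrixP => i j; have /matrixP/(_ i j) := iA; rewrite !mul_quadQ !mxE.
move/(congr1 (@residue R k)); rewrite raddf0 residue_sum => e; rewrite -[RHS]e.
by apply: eq_bigr => l _; rewrite !mxE residueD !residueM.
Qed.

(** The scalar is the ratio at a nonzero Wick coordinate; were it 0, all Pluecker coordinates of a
    Lagrangian subspace would vanish. *)
Lemma wick_vector_pluckerbar_scale (L : fieldType) (F : 'M[L]_(n, n + n)) q :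
  2%:R != 0 :> L -> wick_vector F q ->
  exists2 c, c != 0 & forall lam, pluckerbar F lam =
    if lam \in evens n then c * q lam ^+ 2 else 0.
Proof.
move=> two wF; have [[iF oddF] [mu em qmu] _] := wF.
have plE lam : pluckerbar F lam =
    if lam \in evens n then pluckerbar F mu / q mu ^+ 2 * q lam ^+ 2 else 0.
  case: ifPn => [el|]; last by rewrite finset.in_set negbK => /oddF.
  have := wick_vector_pluckerbar two wF el em => e.
  by rewrite mulrAC -e mulfK // sqrf_eq0.
exists (pluckerbar F mu / q mu ^+ 2) => //.
have [lam] := lagrangian_pluckerbar iF; apply: contra => /eqP c0.
by rewrite plE c0 mul0r; case: ifP.
Qed.
End Reduction.

(** * The initial degeneration as a Lagrangian subspace, and its bases *)

Theorem proposition5p6 (R : realType) (k : closedFieldType) (n : nat)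
    (B : {set {set 'I_n}}) (w : {set 'I_n} -> R) (x : {set 'I_n} -> k)
    (q : {set 'I_n} -> hahn R k) (F : 'M[hahn R k]_(n, n + n))
    (u : 'I_n -> R) :
  [pchar k] =i pred0 ->
  even_delta_matroid B ->
  B \subset evens n ->
  trop_SM k B w ->
  k_point_in_SM B w x ->
  K_point_SM B q ->
  exploded_trop B w x q ->
  wick_vector F q ->
  trop_lin F (minus_plus u) ->
  exists F0 : 'M[k]_(n, n + n),
    [/\ torus_closure (in_lin_ideal F (minus_plus u)) = lin_ideal F0,
        totally_isotropic F0 &
        delta_matroid_of F0 = initial_matroid B w u].
Proof.
move=> k0 _ Bev _ _ [qB _] [c [d [_ wq]]] wF tF.
have two : 2%:R != 0 :> hahn R k.
  by rewrite -(rmorph_nat (@hahnC R k)) fmorph_eq0 ((pcharf0P k).1 k0).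
have [e e0 plF] := wick_vector_pluckerbar_scale two wF.
have [[/totally_isotropicE [rF iF] _] _ _] := wF.
set D := diag_mx (\row_j tpow k (- minus_plus u j)).
have Du : D \in unitmx.
  rewrite unitmxE det_diag unitfE; apply/prodf_neq0 => j _.
  by rewrite mxE tpow_neq0.
have [|s sU AV] := @integral_echelon R k _ _ (F *m D).
  by rewrite mxrankMfree // row_free_unit.
set G := invmx (colsub s (F *m D)) in AV.
have GU : G \in unitmx by rewrite unitmx_inv.
have sA : colsub s (G *m (F *m D)) = 1%:M by rewrite -mulmx_colsub mulVmx.
set A := G *m (F *m D) in AV sA.
have iA : A *m quadQ _ n *m A^T = 0.
  rewrite /A trmx_mul mulmxA -(mulmxA G _ (quadQ _ n)) -(mulmxA G _ (F *m D)^T).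
  by rewrite rescaling_isotropic iF mulmx0 mul0mx.
pose F0 := map_mx (@residue R k) A.
have F0iso : totally_isotropic F0 by apply: residue_isotropic sA iA.
have IE f : in_lin_ideal F (minus_plus u) f <-> lin_ideal F0 f.
  by apply: (in_lin_idealE GU AV sA).
have IE' : in_lin_ideal F (minus_plus u) = lin_ideal F0.
  by apply/funext => f; apply/propext.
have I0 := @lin_ideal0 k n F0.
have ID := @lin_idealD k n F0; have IM := @lin_idealM k n F0.
exists F0; split=> //.
  rewrite IE'; apply/funext => f; apply/propext; rewrite torus_closureP //.
  split=> [[m]|If]; last by exists 0%MM; apply: IM.
  (* By primeness the monomial or [f] lies in the ideal; a monomial would generate the unit Laurent
     ideal, against [tF]. *)
  move=> /(lin_ideal_prime k0 (colsub_residue sA)) [Xm|//].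
  case: tF; rewrite IE'; apply/laurent_unitP => //.
  by exists m.
pose h := fun lam => w lam + \sum_(i in lam) u i.
(* The factor common to all Pluecker coordinates of [A]. *)
pose a := \det G * e * tpow k (- \sum_i u i).
have a0 : a != 0.
  by rewrite !mulf_neq0 ?tpow_neq0 //; move: GU; rewrite unitmxE unitfE.
have plA lam : pluckerbar A lam = if lam \in B then
    a * tpow k ((\sum_(i in lam) u i) *+ 2) * q lam ^+ 2 else 0.
  rewrite pluckerbar_mull rescaling_pluckerbar plF.
  have [lB|lB] := boolP (lam \in B).
    by rewrite (fintype.subsetP Bev _ lB) tpowD /a; ring.
  have /negbFE/eqP -> : (q lam != 0) = false by rewrite qB (negPf lB).
  by rewrite expr0n mulr0 if_same !mulr0.
clearbody a.
have plA0 lam : (pluckerbar A lam != 0) = (lam \in B).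
  rewrite plA; case: ifPn => lB; last by rewrite eqxx.
  by rewrite !mulf_neq0 ?tpow_neq0 // ?sqrf_eq0 ?qB.
(* Squaring [q] doubles the constant [c] by which its valuations differ from [w]. *)
pose C := hval a + c *+ 2.
have hA lam : lam \in B -> hval (pluckerbar A lam) = h lam *+ 2 + C.
  move=> lB; have ql : q lam != 0 by rewrite qB.
  rewrite plA lB !hvalM ?mulf_neq0 ?tpow_neq0 // hval_tpow (wq _ lB).1 /h /C.
  by rewrite !mulr2n; lra.
have V lam : pluckerbar A lam \in @valring R k.
  by apply: det_valring => i j; rewrite mxE.
have resE lam : pluckerbar F0 lam = residue (pluckerbar A lam).
  rewrite [RHS]residue_det => [|i j]; last by rewrite mxE.
  by congr (\det _); apply/matrixP => i j; rewrite !mxE.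
have resN lam : (pluckerbar F0 lam != 0) = (lam \in B) && (h lam *+ 2 + C == 0).
  rewrite resE; have [lB|lB] := boolP (lam \in B).
    by rewrite residue_neq0 ?plA0 // hA.
  by move: lB; rewrite -plA0 negbK => /eqP ->; rewrite raddf0 eqxx.
have Hge lam : lam \in B -> 0 <= h lam *+ 2 + C.
  by move=> lB; have := V lam; rewrite valring_hval ?plA0 // hA.
(* The lower bound [Hge] is attained at [lam0], so [h lam *+ 2 + C] is 0 exactly when [h lam] is
   least over [B]. *)
have [lam0] := lagrangian_pluckerbar F0iso.
rewrite resN => /andP[l0B /eqP hl0].
apply/setP => lam; rewrite !finset.in_set resN; apply/andb_id2l => lB.
apply/eqP/forall_inP => [hl mu mB|/(_ _ l0B) le0].
  by have := Hge mu mB; rewrite -/(h lam) -/(h mu) !mulr2n in hl *; lra.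
by have := Hge lam lB; move: le0 hl0; rewrite -/(h lam) -/(h lam0) !mulr2n; lra.
Qed.
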